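(* Let $\mathbb K\in\{\mathbb R,\mathbb C\}$, and let $X\subseteq\mathbb K^n$ be a germ at $0$ of an analytic complete intersection locally defined by $$X=\{x\in(\mathbb K^n,0):\ f_1(x)=\cdots=f_p(x)=0\},$$ where $f_i=(f_i)_{m_i}+(f_i)_{m_i+1}+(f_i)_{m_i+2}+\cdots$ is the expansion of $f_i$ into homogeneous components and $m_i=\operatorname{ord}_0(f_i)$. Fix $u\in T_0X\setminus\{0\}$. Assume that $X$ is nondegenerate along $u$ in the sense that the $p\times n$ matrix with rows $$\nabla(f_i)_{m_i}(u),\qquad i=1,\dots,p,$$ has rank $p$. Then $X$ is second-order realizable along $u$. Consequently, $T^2_{0,u}X=T^{2,a}_{0,u}X$.
   Context: An analytic function is one that is locally given by convergent power series (real-analytic for $\mathbb K=\mathbb R$, holomorphic for $\mathbb K=\mathbb C$). $\mathcal I(X,0)$ is the ideal of germs at $0$ of analytic functions on $\mathbb K^n$ that vanish on $X\cap V$ for some neighborhood $V$ of $0$. $X$ is an analytic complete intersection at $0$ if $\mathcal I(X,0)$ can be generated by exactly $p=n-\dim_0X$ analytic function germs, $\mathcal I(X,0)=\langle f_1,\dots,f_p\rangle$, and near $0$ one has $X=\{x: f_1(x)=\cdots=f_p(x)=0\}$; the $f_i$ in the claim are such germs. Geometric tangent cone: $T_0X$ is the set of $v\in\mathbb K^n$ for which there are $x_k\in X\setminus\{0\}$ and real $t_k>0$ with $x_k\to0$ and $t_kx_k\to v$. For a nonzero germ $f=f_m+f_{m+1}+\cdots$ (power series expansion at $0$ into homogeneous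 polynomials $f_j$ of degree $j$, with $f_m\not\equiv0$), $\operatorname{ord}_0(f):=m$, $f^{[*]}:=f_m$ is the initial form and $f^{[*]+1}:=f_{m+1}$ (possibly zero). $T^2_{0,u}X$ is the set of all $w\in\mathbb K^n$ for which there are positive real numbers $t_k\downarrow0$ and $w_k\in\mathbb K^n$ with $w_k\to w$ such that $t_ku+\frac12t_k^2w_k\in X$ for every $k$. $T^{2,a}_{0,u}X:=\{w\in\mathbb K^n:\ \tfrac12\langle\nabla f^{[*]}(u),w\rangle+f^{[*]+1}(u)=0\ \text{ for all nonzero } f\in\mathcal I(X,0)\}$, where $\nabla$ is the vector of partial derivatives over $\mathbb K$ and $\langle a,b\rangle=\sum_i a_ib_i$ (bilinear). $X$ is second-order realizable along $u$ if for every $w\in T^{2,a}_{0,u}X$ there exist $\varepsilon>0$ and an analytic curve $\gamma:(0,\varepsilon)\to X$ such that $\gamma(t)=tu+\frac12t^2w+o(t^2)$ as $t\to0^+$. A curve on the real interval $(0,\varepsilon)$ is analytic if near each point its components are given by convergent power series in $t$ with coefficients in $\mathbb K$. *)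

(* Defs.v *)
From HB Require Import structures.
From mathcomp Require Import all_boot all_order all_algebra.
(* The notations of [mpoly] clash with those of mathcomp-analysis. *)
From mathcomp Require Import -(notations) mpoly.
From mathcomp Require Import boolp classical_sets reals topology normedtype.
From mathcomp Require Import sequences.
Set Implicit Arguments.
Unset Strict Implicit.
Unset Printing Implicit Defensive.
Import Order.TTheory GRing.Theory Num.Theory.
Import numFieldNormedType.Exports.
Local Open Scope classical_set_scope.
Local Open Scope ring_scope.

(* Everything is stated over an arbitrary [K : numFieldType] and is meant for
   K = R and K = R[i], [R : realType].  In the order of a numFieldType an
   inequality [0 < t] forces [t] to be real (in R[i]: zero imaginary part and
   positive real part).  Hence {t : K | 0 < t < eps} is the real interval
   (0, eps), and [0^'+] is the filter of real t -> 0+, also when K = R[i].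

   A germ at 0 is represented by a function, resp. a set, on the whole of K^n
   of which only the behaviour near 0 matters. *)

Section PowerSeries.
Context {K : numFieldType} {n : nat}.
Implicit Types (a : multinom n -> K) (f : 'rV[K]_n -> K) (x u : 'rV[K]_n).

(* Degree-j part of the power series sum_m a_m X^m; [bmultinom n j.+1] is the
   finite type of the exponents of total degree at most j. *)
Definition homog_part a (j : nat) : mpoly n K :=
  \sum_(m : bmultinom n j.+1 | mdeg m == j) a m *: mpolyX K m.

(* f(y) = sum_m a_m (y - x)^m for y near x.  The first conjunct is
   sum_m |a_m (y - x)^m| < oo, so that summing by degree is harmless. *)
Definition power_series_at x f a : Prop :=
  \forall y \near x,
    cvgn (series (fun j => meval (fun i => `|(y - x) 0 i|)
                             (homog_part (fun m => `|a m|) j))) /\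
    series (fun j => meval ((y - x) 0) (homog_part a j)) @ \oo --> f y.

Definition analytic_at x f : Prop := exists a, power_series_at x f a.

Definition analytic_germ f : Prop := \forall x \near (0 : 'rV[K]_n), analytic_at x f.

Definition zero_germ f : Prop := \forall x \near (0 : 'rV[K]_n), f x = 0.

(* The (unique) coefficients of the expansion of f at 0. *)
Definition taylor f : multinom n -> K :=
  xget (fun=> 0) [set a | power_series_at 0 f a].

Definition component f (j : nat) : mpoly n K := homog_part (taylor f) j.

(* Only meaningful for a nonzero analytic germ. *)
Definition order0 f : nat :=
  xget 0%N [set m | component f m != 0 /\
                    forall j, (j < m)%N -> component f j = 0].

Definition initial_form f : mpoly n K := component f (order0 f).

Definition next_form f : mpoly n K := component f (order0 f).+1.

Definition gradient (P : mpoly n K) u : 'rV[K]_n :=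
  \row_(i < n) meval (u 0) (mderiv i P).

End PowerSeries.

Section AnalyticSets.
Context {K : numFieldType} {n : nat}.
Implicit Types (X : set 'rV[K]_n) (f g : 'rV[K]_n -> K) (u v w : 'rV[K]_n).

Definition vanishing_ideal X : set ('rV[K]_n -> K) :=
  [set f | analytic_germ f /\
           \forall x \near (0 : 'rV[K]_n), X x -> f x = 0].

Definition generated_ideal p (f : 'I_p -> 'rV[K]_n -> K) : set ('rV[K]_n -> K) :=
  [set g | exists2 h : 'I_p -> 'rV[K]_n -> K, forall i, analytic_germ (h i) &
           \forall x \near (0 : 'rV[K]_n), g x = \sum_(i < p) h i x * f i x].

(* Every neighbourhood V of 0 contains a d-dimensional analytic submanifold
   included in X.  The submanifold is given by a local parametrization phi, the
   germ at 0 in K^d of an analytic immersion: the rows of the matrix below are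
   the gradients of the linear parts of the components of phi, so it is the
   Jacobian matrix of phi at 0. *)
Definition contains_manifolds X (d : nat) : Prop :=
  forall V : set 'rV[K]_n, nbhs (0 : 'rV[K]_n) V ->
  exists phi : 'rV[K]_d -> 'rV[K]_n,
    [/\ forall j, analytic_germ (fun y => phi y 0 j),
        \rank (\matrix_(j < n)
                 gradient (component (fun y => phi y 0 j) 1) 0) = d &
        \forall y \near (0 : 'rV[K]_d), (X `&` V) (phi y)].

(* dim_0 X, for 0 in the closure of X. *)
Definition local_dim X : nat :=
  (\max_(d < n.+1 | `[< contains_manifolds X d >]) d)%N.

Definition complete_intersection X p (f : 'I_p -> 'rV[K]_n -> K) : Prop :=
  [/\ forall i, analytic_germ (f i),
      vanishing_ideal X = generated_ideal f,
      p = (n - local_dim X)%N &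
      \forall x \near (0 : 'rV[K]_n), X x <-> forall i, f i x = 0].

Definition tangent_cone X : set 'rV[K]_n :=
  [set v | exists (x : nat -> 'rV[K]_n) (t : nat -> K),
    [/\ forall k, [/\ X (x k), x k != 0 & 0 < t k],
        x @ \oo --> (0 : 'rV[K]_n) &
        (fun k => t k *: x k) @ \oo --> v]].

Definition second_tangent_set X u : set 'rV[K]_n :=
  [set w | exists (t : nat -> K) (w_ : nat -> 'rV[K]_n),
    [/\ forall k, 0 < t k,
        nonincreasing_seq t,
        t @ \oo --> (0 : K),
        w_ @ \oo --> w &
        forall k, X (t k *: u + (2^-1 * t k ^+ 2) *: w_ k)]].

Definition algebraic_second_tangent_set X u : set 'rV[K]_n :=
  [set w | forall f, vanishing_ideal X f -> ~ zero_germ f ->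
    2^-1 * (\sum_(i < n) gradient (initial_form f) u 0 i * w 0 i)
      + meval (u 0) (next_form f) = 0].

Definition analytic_curve (eps : K) (c : K -> 'rV[K]_n) : Prop :=
  forall t0, 0 < t0 < eps -> forall i : 'I_n,
  exists b : nat -> K, \forall t \near t0, 0 < t < eps ->
    series (fun k => b k * (t - t0) ^+ k) @ \oo --> c t 0 i.

Definition second_order_realizable X u : Prop :=
  forall w, algebraic_second_tangent_set X u w ->
  exists (eps : K) (c : K -> 'rV[K]_n),
    [/\ 0 < eps,
        forall t, 0 < t < eps -> X (c t),
        analytic_curve eps c &
        t ^- 2 *: (c t - (t *: u + (2^-1 * t ^+ 2) *: w)) @[t --> 0^'+]
          --> (0 : 'rV[K]_n)].

End AnalyticSets.

(* Main.v *)
Require Import Defs.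
From mathcomp Require Import all_boot all_order all_algebra.
From mathcomp Require Import complex.
From mathcomp Require Import -(notations) mpoly.
From mathcomp Require Import boolp classical_sets reals topology normedtype.
From mathcomp Require Import sequences.
Import Order.TTheory GRing.Theory Num.Theory.
Import numFieldNormedType.Exports.
Local Open Scope complex_scope.
Local Open Scope classical_set_scope.
Local Open Scope ring_scope.

(* Put x = t u + t^2 z(t) in f_i, of order m_i. Since u is tangent to X,
   (f_i)_(m_i)(u) = 0, so
     t^(-m_i-1) f_i(x) = (f_i)_(m_i+1)(u) + <grad (f_i)_(m_i)(u), z> + t H_i(t, z).
   If w is algebraic, z = w/2 cancels the first two terms; with B a right inverse
   of the gradient matrix and z = w/2 + B y, the system becomes y = - t H(t, z).
   Its Picard iterates from 0 are polynomials in t that stabilize coefficientwise,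
   and their norms sum_k |y_k| r^k stay below 1 for r small: the limit is a
   convergent power series, by a majorant argument that needs neither the implicit
   function theorem nor complex analysis. The same expansion of f along arcs
   shows that second-order tangents satisfy the algebraic equations. *)

Set Implicit Arguments.
Unset Strict Implicit.
Unset Printing Implicit Defensive.

(** * Weighted l1 norms on polynomial rings *)

(** All estimates are made on polynomials, namely truncated series and Picard iterates, so they are
    purely algebraic and the same over R and C; limits are taken only at the end, where
    [complete_field] collects what is required of K. The obstacle is that isolating H divides by a
    power of the arc variable, at the price of a negative power of the radius. With a single radius
    r this price would cancel the smallness gained from the factor t in y = - t H(t, z). Hence the
    variable s of the arc is measured at a fixed radius r0 and the variable t of z at a radius r <=
    r0: the price r0^(-m-2) does not depend on r, and r can be shrunk afterwards. The iteration
    contracts only t-adically. The norms merely keep the iterates in a ball, so no Lipschitz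
    estimate of H enters. Finally, the algebraic equations concern nonzero germs only; that the f_i
    are such germs has to be deduced from their nonzero gradients. *)

Section SubmultiplicativeNorms.
Context {K : numFieldType}.

(** Replaces a minimum: the order of K is partial, but positive elements are real and hence
    comparable. *)
Lemma exists_pos_le (a b : K) : 0 < a -> 0 < b ->
  exists e, [/\ 0 < e, e <= a & e <= b].
Proof.
move=> a0 b0; have [ab|ba] := real_leP (gtr0_real a0) (gtr0_real b0).
  by exists a.
by exists b; split=> //; apply: ltW.
Qed.

Lemma exists_radius (R D : K) : 0 < R -> 0 <= D ->
  exists r, [/\ 0 < r, r <= 1 & r * D <= R].
Proof.
move=> R0 D0; have D1 : 0 < D + 1 by rewrite ltr_wpDl.
have [r [r0 r1 rR]] := exists_pos_le ltr01 (divr_gt0 R0 D1).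
exists r; split=> //; rewrite ler_pdivlMr // in rR; apply: le_trans rR.
by rewrite ler_wpM2l ?(ltW r0) // lerDl.
Qed.

(** Kept abstract so that [pnorm] can be iterated, from K to K[t] and from K[t] to K[t][s]. Only
    upper bounds are derived from it, whence the inequality for 1. *)
Record submult {A : comNzRingType} (N : A -> K) : Prop := Submult {
  submult0 : N 0 = 0;
  submult1 : N 1 <= 1;
  submult_ge0 : forall x, 0 <= N x;
  submultD : forall x y, N (x + y) <= N x + N y;
  submultM : forall x y, N (x * y) <= N x * N y }.

Lemma submult_norm : submult (fun x : K => `|x|).
Proof.
split=> //; [exact: normr0|by rewrite normr1|exact: ler_normD|].
by move=> x y; rewrite normrM.
Qed.

(** As the value of a majorant polynomial, it makes norm inequalities reduce to coefficientwise ones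
    through [le_horner_coef]. *)
Definition pnorm {A : comNzRingType} (N : A -> K) (r : K) (q : {poly A}) : K :=
  (map_poly N q).[r].

Context {A : comNzRingType} {N : A -> K} (hN : submult N).

Let coef_mapN q k : (map_poly N q)`_k = N q`_k.
Proof. exact/coef_map_id0/submult0. Qed.

Lemma submult_sum I (s : seq I) P (F : I -> A) :
  N (\sum_(i <- s | P i) F i) <= \sum_(i <- s | P i) N (F i).
Proof.
elim/big_rec2: _ => [|i y x _ le_xy]; first by rewrite submult0.
by apply: (le_trans (submultD hN _ _)); rewrite lerD2l.
Qed.

Lemma submultX (x : A) k : N (x ^+ k) <= N x ^+ k.
Proof.
elim: k => [|k IHk]; first by rewrite !expr0 submult1.
rewrite !exprS; apply: (le_trans (submultM hN _ _)).
by rewrite ler_wpM2l ?submult_ge0.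
Qed.

Lemma le_horner_coef (P Q : {poly K}) r :
  0 <= r -> (forall k, P`_k <= Q`_k) -> P.[r] <= Q.[r].
Proof.
move=> r0 le_PQ.
rewrite (@horner_coef_wide _ (maxn (size P) (size Q)) P) ?leq_maxl //.
rewrite (@horner_coef_wide _ (maxn (size P) (size Q)) Q) ?leq_maxr //.
by apply: ler_sum => k _; rewrite ler_wpM2r ?exprn_ge0.
Qed.

Lemma pnormE M r (q : {poly A}) : (size q <= M)%N ->
  pnorm N r q = \sum_(k < M) N q`_k * r ^+ k.
Proof.
move=> leM; rewrite /pnorm (@horner_coef_wide _ M).
  by apply: eq_bigr => k _; rewrite coef_mapN.
by apply: (leq_trans _ leM); rewrite map_polyE (leq_trans (size_Poly _)) // size_map.
Qed.

Lemma submult_pnorm r : 0 <= r -> submult (pnorm N r).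
Proof.
move=> r0; split.
- by rewrite /pnorm map_poly0 horner0.
- rewrite (@pnormE 1) ?size_poly1 // big_ord1 expr0 mulr1 coef1 eqxx.
  exact: submult1.
- move=> q; rewrite (@pnormE (size q)) //.
  by apply: sumr_ge0 => k _; rewrite mulr_ge0 ?exprn_ge0 ?submult_ge0.
- move=> p q; rewrite /pnorm -hornerD; apply: le_horner_coef => // k.
  by rewrite coefD !coef_mapN coefD submultD.
- move=> p q; rewrite /pnorm -hornerM; apply: le_horner_coef => // k.
  rewrite coefM coef_mapN coefM; apply: (le_trans (submult_sum _ _ _)).
  by apply: ler_sum => i _; rewrite !coef_mapN submultM.
Qed.

Lemma pnormC r (c : A) : pnorm N r c%:P = N c.
Proof.
by rewrite (@pnormE 1) ?size_polyC_leq1 // big_ord1 coefC eqxx expr0 mulr1.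
Qed.

Lemma pnormX r : 0 <= r -> pnorm N r 'X <= r.
Proof.
move=> r0; rewrite (@pnormE 2) ?size_polyX // !big_ord_recl big_ord0 !coefX /=.
rewrite submult0 // mul0r add0r addr0 expr1 -[leRHS]mul1r.
by rewrite ler_wpM2r ?submult1.
Qed.

Lemma pnormXnM r k (q : {poly A}) : pnorm N r ('X^k * q) = r ^+ k * pnorm N r q.
Proof.
rewrite /pnorm -[r ^+ k]hornerXn -hornerM; congr (_.[r]); apply/polyP => i.
by rewrite coef_mapN !coefXnM coef_mapN; case: ifP => // _; apply: submult0.
Qed.

Lemma pnorm_coef r (q : {poly A}) k : 0 <= r -> N q`_k * r ^+ k <= pnorm N r q.
Proof.
move=> r0; rewrite (@pnormE (maxn (size q) k.+1)) ?leq_maxl //.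
have hk : (k < maxn (size q) k.+1)%N by rewrite leq_maxr.
rewrite (bigD1 (Ordinal hk)) //= lerDl; apply: sumr_ge0 => i _.
by rewrite mulr_ge0 ?exprn_ge0 ?submult_ge0.
Qed.

(** Source of the negative powers of the radius in the later constants. *)
Lemma pnorm_drop r k (q : {poly A}) : 0 <= r ->
  r ^+ k * pnorm N r (drop_poly k q) <= pnorm N r q.
Proof.
move=> r0; rewrite /pnorm -[r ^+ k]hornerXn -hornerM; apply: le_horner_coef => // i.
rewrite coefXnM; case: ltnP => le_ki; rewrite !coef_mapN ?submult_ge0 //.
by rewrite coef_drop_poly subnK.
Qed.

Lemma ler_pnorm r r' (q : {poly A}) : 0 <= r -> r <= r' -> pnorm N r q <= pnorm N r' q.
Proof.
move=> r0 rr'; rewrite !(@pnormE (size q)) //; apply: ler_sum => k _.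
by rewrite ler_wpM2l ?submult_ge0 // lerXn2r ?nnegrE // (le_trans r0).
Qed.

(** Taken with x the variable of K[t], it controls the substitution s = t in K[t][s]. *)
Lemma submult_horner (q : {poly A}) x : N q.[x] <= pnorm N (N x) q.
Proof.
rewrite horner_coef (@pnormE (size q)) //; apply: (le_trans (submult_sum _ _ _)).
apply: ler_sum => k _; apply: (le_trans (submultM hN _ _)).
by rewrite ler_wpM2l ?submult_ge0 ?submultX.
Qed.

Lemma pnorm_partial_sum r (q : {poly A}) M : 0 <= r ->
  \sum_(k < M) N q`_k * r ^+ k <= pnorm N r q.
Proof.
move=> r0; rewrite (@pnormE (M + size q)) ?leq_addl // big_split_ord /= lerDl.
by apply: sumr_ge0 => i _; rewrite mulr_ge0 ?exprn_ge0 ?submult_ge0.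
Qed.

End SubmultiplicativeNorms.

(** * Majorants of homogeneous parts *)

Section PowerSeriesCoefficients.
Context {K : numFieldType} {n : nat}.
Implicit Types (a : multinom n -> K).

(** The series of the [R ^+ j * l1 a j] is the majorant of the power series at the point whose
    coordinates all equal R. *)
Definition l1 a j : K := \sum_(m : bmultinom n j.+1 | mdeg m == j) `|a m|.

Lemma l1_ge0 a j : 0 <= l1 a j.
Proof. exact: sumr_ge0. Qed.

Context {A : comNzRingType} (phi : {rmorphism K -> A}).

Lemma mmap_homog_part a j (h : 'I_n -> A) :
  mmap phi h (homog_part a j) =
  \sum_(m : bmultinom n j.+1 | mdeg m == j) phi (a m) * \prod_(i < n) h i ^+ m i.
Proof.
rewrite /homog_part raddf_sum; apply: eq_bigr => m _.
by rewrite /= mmapZ mmapX.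
Qed.

Lemma mmap_homog_partZ a j c (h : 'I_n -> A) :
  mmap phi (fun i => c * h i) (homog_part a j) =
  c ^+ j * mmap phi h (homog_part a j).
Proof.
rewrite !mmap_homog_part mulr_sumr; apply: eq_bigr => m /eqP deg_m.
rewrite mulrCA; congr (_ * _).
under eq_bigr do rewrite exprMn.
by rewrite big_split /= prodrXr -mdegE deg_m.
Qed.

Lemma submult_homog_part (N : A -> K) a j (h : 'I_n -> A) D :
  submult N -> (forall c, N (phi c) <= `|c|) -> (forall i, N (h i) <= D) ->
  N (mmap phi h (homog_part a j)) <= D ^+ j * l1 a j.
Proof.
move=> hN Nphi hD; rewrite mmap_homog_part /l1 mulr_sumr.
apply: (le_trans (submult_sum hN _ _ _)); apply: ler_sum => m /eqP deg_m.
apply: (le_trans (submultM hN _ _)); rewrite mulrC.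
apply: ler_pM; rewrite ?submult_ge0 //.
rewrite -[in leRHS]deg_m mdegE -prodrXr.
elim/big_rec2: _ => [|i x y _ le_yx]; first exact: submult1.
apply: (le_trans (submultM hN _ _)); apply: ler_pM; rewrite ?submult_ge0 //.
apply: (le_trans (submultX hN _ _)).
by rewrite lerXn2r ?nnegrE ?(le_trans _ (hD i)) ?submult_ge0.
Qed.

End PowerSeriesCoefficients.

Section FirstOrderExpansion.
Context {K : numFieldType} {n : nat} {A : comNzRingType} (phi : {rmorphism K -> A}).

(** The property passes to products by the Leibniz rule and to linear combinations, so checking 1
    and the variables is enough. *)
Lemma mmap_coef01 (P : mpoly n K) (u : 'I_n -> K) (z : 'I_n -> A) :
  let q := mmap (polyC \o phi) (fun i => (phi (u i))%:P + (z i)%:P * 'X) P in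
  q`_0 = phi (meval u P) /\
  q`_1 = \sum_(i < n) phi (meval u (mderiv i P)) * z i.
Proof.
pose h i := (phi (u i))%:P + (z i)%:P * 'X.
pose T P := (mmap (polyC \o phi) h P)`_0 = phi (meval u P) /\
  (mmap (polyC \o phi) h P)`_1 = \sum_(i < n) phi (meval u (mderiv i P)) * z i.
rewrite -/(T P).
have TM P1 P2 : T P1 -> T P2 -> T (P1 * P2).
  move=> [e0 e1] [f0 f1]; split.
    by rewrite rmorphM coefM big_ord1 subnn e0 f0 mevalM rmorphM.
  rewrite rmorphM coefM big_ord_recl big_ord1 /= /bump /= subnn subn0 e0 e1 f0 f1.
  rewrite mulr_sumr mulr_suml -big_split /=; apply: eq_bigr => i _.
  rewrite mderivM mevalD !mevalM rmorphD !rmorphM /= mulrDl addrC.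
  by congr (_ + _); rewrite ?mulrA // mulrAC.
have T1 : T 1.
  split; first by rewrite [mmap _ _ _]rmorph1 coef1 meval1 [RHS]rmorph1.
  rewrite [mmap _ _ _]rmorph1 coef1 big1 // => i _.
  by rewrite -mpolyC1 mderivC meval0 rmorph0 mul0r.
have TX i : T (mpolyX K (mnm1 i)).
  rewrite /T mmapX mmap1U /h !coefD !coefC !coefMX /= coefC addr0 add0r mevalXU.
  split=> //; rewrite (bigD1 i) //= big1 => [|j neq_ji]; rewrite mderivX mevalZ mnm1E.
    rewrite eqxx mul1r addr0 (_ : mnm_sub _ _ = mnm0); last first.
      by apply/mnmP => k; rewrite mnmBE subnn mnm0E.
    by rewrite mpolyX0 meval1 rmorph1 mul1r.
  by rewrite eq_sym (negbTE neq_ji) mul0r rmorph0 mul0r.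
have TXm m : T (mpolyX K m).
  rewrite mpolyXE_id; apply: big_ind => [||i _]; [exact: T1|exact: TM|].
  elim: (m i) => [|k IHk]; first by rewrite expr0.
  by rewrite exprS; apply: (TM _ _ (TX i) IHk).
rewrite (mpolyE P); apply: (big_ind T) => [|P1 P2 [e0 e1] [f0 f1]|m _].
- split; first by rewrite raddf0 coef0 meval0 rmorph0.
  by rewrite raddf0 coef0 big1 // => i _; rewrite mderiv0 meval0 rmorph0 mul0r.
- split; first by rewrite raddfD /= coefD e0 f0 mevalD rmorphD.
  rewrite raddfD /= coefD e1 f1 -big_split; apply: eq_bigr => i _ /=.
  by rewrite mderivD mevalD rmorphD mulrDl.
- have [e0 e1] := TXm m; rewrite /T mmapZ /=.
  split; first by rewrite coefCM e0 mevalZ rmorphM.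
  rewrite coefCM e1 mulr_sumr; apply: eq_bigr => i _.
  by rewrite mderivZ mevalZ rmorphM mulrA.
Qed.

End FirstOrderExpansion.

(** * Power series along arcs *)

Section Arcs.
Context {K : numFieldType} {n : nat} {A : comNzRingType} (phi : {rmorphism K -> A}).
Implicit Types (a : multinom n -> K) (u : 'I_n -> K) (z : 'I_n -> A).

(* The truncated series along the arc s |-> s u + s^2 z. The ring A is K when z
   is a vector, and K[t] when z is itself an unknown function of t; in the
   latter case s is set to t only at the end, so that the orders in t coming
   from the arc and from z are kept apart. *)
Definition arc_poly a J u z : {poly A} :=
  \sum_(j < J) mmap (polyC \o phi)
    (fun i => (phi (u i))%:P * 'X + (z i)%:P * 'X^2) (homog_part a j).

(** Since s u + s^2 z = s (u + s z), degree j contributes nothing below s^j. So truncating the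
    series alters only high powers of s, and [mmap_coef01] gives the lowest coefficients. *)
Lemma arc_polyE a J u z :
  arc_poly a J u z = \sum_(j < J) 'X^j *
    mmap (polyC \o phi) (fun i => (phi (u i))%:P + (z i)%:P * 'X) (homog_part a j).
Proof.
apply: eq_bigr => j _; rewrite -mmap_homog_partZ !mmap_homog_part.
apply: eq_bigr => m _; congr (_ * _); apply: eq_bigr => i _; congr (_ ^+ _).
by rewrite [RHS]mulrC mulrDl -mulrA -expr2.
Qed.

Lemma arc_poly_extend a J J' u z : (J <= J')%N ->
  exists G, arc_poly a J' u z = arc_poly a J u z + G * 'X^J.
Proof.
move=> leJ; rewrite !arc_polyE -(subnKC leJ) big_split_ord /=.
exists (\sum_(j < J' - J) 'X^j * mmap (polyC \o phi)
  (fun i => (phi (u i))%:P + (z i)%:P * 'X) (homog_part a (J + j))).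
congr (_ + _); rewrite mulr_suml; apply: eq_bigr => j _.
by rewrite exprD -mulrA mulrC.
Qed.

Lemma arc_poly_horner a J u z x :
  (arc_poly a J u z).[x] =
  \sum_(j < J) mmap phi (fun i => phi (u i) * x + z i * x ^+ 2) (homog_part a j).
Proof.
rewrite /arc_poly -[LHS]/(horner_eval x _) rmorph_sum; apply: eq_bigr => j _.
rewrite !mmap_homog_part rmorph_sum; apply: eq_bigr => m _.
rewrite rmorphM rmorph_prod /= /horner_eval hornerC; congr (_ * _).
by apply: eq_bigr => i _; rewrite !hornerE.
Qed.

(** As sigma <= 1, the coordinates of the arc have norm at most sigma D + sigma^2 rho <= sigma (D +
    rho) <= R, a radius at which S bounds the majorant. *)
Lemma arc_poly_norm (N : A -> K) a J u z D rho sigma R S :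
  submult N -> (forall c, N (phi c) <= `|c|) ->
  (forall i, `|u i| <= D) -> (forall i, N (z i) <= rho) ->
  0 <= D -> 0 <= rho -> 0 <= sigma <= 1 -> sigma * (D + rho) <= R ->
  (forall J, \sum_(j < J) R ^+ j * l1 a j <= S) ->
  pnorm N sigma (arc_poly a J u z) <= S.
Proof.
move=> hN Nphi uD zrho D0 rho0 /andP[s0 s1] sR RS.
have hP := submult_pnorm hN s0.
apply: le_trans (RS J); apply: (le_trans (submult_sum hP _ _ _)).
apply: ler_sum => j _.
apply: (submult_homog_part (phi := (polyC \o phi : {rmorphism _ -> _}))) => // [c|i].
  by rewrite /= pnormC.
apply: le_trans sR; rewrite mulrDr; apply: (le_trans (submultD hP _ _)).
apply: lerD.
  rewrite mulrC -['X]expr1 (pnormXnM hN) expr1 (pnormC hN).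
  by rewrite ler_wpM2l // (le_trans (Nphi _)).
rewrite mulrC (pnormXnM hN) (pnormC hN).
by apply: ler_pM; rewrite ?exprn_ge0 ?(submult_ge0 hN) // expr2 ler_piMr.
Qed.

Lemma arc_poly_coef a m J u z :
  (forall j, (j < m)%N -> homog_part a j = 0) -> (m.+2 <= J)%N ->
  [/\ forall k, (k < m)%N -> (arc_poly a J u z)`_k = 0,
      (arc_poly a J u z)`_m = phi (meval u (homog_part a m)) &
      (arc_poly a J u z)`_m.+1 = phi (meval u (homog_part a m.+1)) +
        \sum_(i < n) phi (meval u (mderiv i (homog_part a m))) * z i].
Proof.
move=> a0 leJ.
pose q j :=
  mmap (polyC \o phi) (fun i => (phi (u i))%:P + (z i)%:P * 'X) (homog_part a j).
have q0 j : (j < m)%N -> q j = 0 by move=> /a0 e; rewrite /q e raddf0.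
have cE k : (arc_poly a J u z)`_k =
    \sum_(j < J) if (k < j)%N then 0 else (q j)`_(k - j).
  by rewrite arc_polyE coef_sum; apply: eq_bigr => j _; rewrite coefXnM.
have [c0 c1] := mmap_coef01 phi (homog_part a m) u z.
have [d0 _] := mmap_coef01 phi (homog_part a m.+1) u z.
have hm : (m < J)%N by rewrite ltnW.
split.
- move=> k lt_km; rewrite cE big1 // => j _; case: ltnP => // le_jk.
  by rewrite q0 ?coef0 // (leq_ltn_trans le_jk).
- rewrite cE (bigD1 (Ordinal hm)) //= ltnn subnn c0 big1 ?addr0 // => j neq.
  case: ltnP => // le_jm; rewrite q0 ?coef0 // ltn_neqAle le_jm andbT.
  by apply: contra neq => /eqP e; apply/eqP/val_inj.
- rewrite cE (bigD1 (Ordinal hm)) //= (bigD1 (Ordinal leJ)) /=; last first.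
    by apply/eqP => -[] /eqP; rewrite eqn_leq ltnn.
  rewrite ltnn subnn ltnNge leqnSn /= subSnn c1 d0 addrC; congr (_ + _).
  rewrite big1 ?addr0 // => j /andP[neq neq'].
  case: ltnP => // le_jm; rewrite q0 ?coef0 // ltn_neqAle.
  apply/andP; split; first by apply: contra neq => /eqP e; apply/eqP/val_inj.
  rewrite -ltnS ltn_neqAle le_jm andbT.
  by apply: contra neq' => /eqP e; apply/eqP/val_inj.
Qed.

(** Meant for coefficientwise congruence modulo t^k on K[t][s], handled as a relation instead of
    through a quotient ring. *)
Lemma mmap_homog_part_rel (E : A -> A -> Prop) a j (h h' : 'I_n -> A) :
  (forall x, E x x) -> (forall x x' y y', E x x' -> E y y' -> E (x + y) (x' + y')) ->
  (forall x x' y y', E x x' -> E y y' -> E (x * y) (x' * y')) ->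
  (forall i, E (h i) (h' i)) ->
  E (mmap phi h (homog_part a j)) (mmap phi h' (homog_part a j)).
Proof.
move=> Er ED EM Eh; rewrite !mmap_homog_part.
apply: (big_ind2 E) => [//|x1 x2 y1 y2|m _]; first exact: ED.
apply: (EM _ _ _ _) => //.
apply: (big_ind2 E) => [//|x1 x2 y1 y2|i _]; first exact: EM.
by elim: (m i) => [|k IHk]; rewrite ?expr0 // !exprS; apply: (EM _ _ _ _).
Qed.

End Arcs.

(** * Remainders along arcs, modulo powers of t *)

Section ArcRemainder.
Context {K : numFieldType} {n : nat}.
Implicit Types (a : multinom n -> K) (u : 'I_n -> K) (z : 'I_n -> {poly K}).
Implicit Types (p q : {poly K}) (G : {poly {poly K}}).

Definition eqmodX k p q := forall j, (j < k)%N -> p`_j = q`_j.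

Lemma eqmodXD k p p' q q' :
  eqmodX k p p' -> eqmodX k q q' -> eqmodX k (p + q) (p' + q').
Proof. by move=> e f j lt_jk; rewrite !coefD e ?f. Qed.

Lemma eqmodXM k p p' q q' :
  eqmodX k p p' -> eqmodX k q q' -> eqmodX k (p * q) (p' * q').
Proof.
move=> e f j lt_jk; rewrite !coefM; apply: eq_bigr => i _.
by rewrite e ?f // (leq_ltn_trans _ lt_jk) ?leq_subr // -ltnS.
Qed.

Lemma eqmodX_XnM k p q : eqmodX k (p + q * 'X^k) p.
Proof. by move=> j lt_jk; rewrite coefD coefMXn lt_jk addr0. Qed.

Lemma eqmodX_leq k l p q : (l <= k)%N -> eqmodX k p q -> eqmodX l p q.
Proof. by move=> le_lk e j lt_jl; rewrite e // (leq_trans lt_jl). Qed.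

Lemma eqmodX_sum k I (r : seq I) (P : pred I) (F F' : I -> {poly K}) :
  (forall i, eqmodX k (F i) (F' i)) ->
  eqmodX k (\sum_(i <- r | P i) F i) (\sum_(i <- r | P i) F' i).
Proof.
move=> e; apply: (big_ind2 (eqmodX k)) => [//|x1 x2 y1 y2|i _]; last exact: e.
exact: eqmodXD.
Qed.

Lemma eqmodX_horner k G G' :
  (forall l, eqmodX k G`_l G'`_l) -> eqmodX k G.['X] G'.['X].
Proof.
move=> e; pose M := maxn (size G) (size G').
rewrite !(@horner_coef_wide _ M) ?leq_maxl ?leq_maxr //.
by apply: eqmodX_sum => l; apply: eqmodXM.
Qed.

(* If f has order m at 0 and f_m(u) = 0, then along x = t u + t^2 z(t) it equals
   t^(m+1) (f_(m+1)(u) + <grad f_m(u), z> + t arc_remainder). *)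
Definition arc_remainder a m J u z : {poly K} :=
  (drop_poly m.+2 (arc_poly polyC a J u z)).['X].

Lemma arc_poly_remainder a m J u z :
  (forall j, (j < m)%N -> homog_part a j = 0) -> meval u (homog_part a m) = 0 ->
  (m.+2 <= J)%N ->
  (arc_poly polyC a J u z).['X] = 'X^(m.+1) *
    ((meval u (homog_part a m.+1))%:P +
     \sum_(i < n) (meval u (mderiv i (homog_part a m)))%:P * z i
     + 'X * arc_remainder a m J u z).
Proof.
move=> a0 am leJ; have [c0 c1 c2] := arc_poly_coef polyC u z a0 leJ.
rewrite -[in LHS](poly_take_drop m.+2 (arc_poly _ _ _ _ _)) hornerD hornerM hornerXn.
rewrite mulrDr [in RHS]mulrA -exprSr; congr (_ + _); last by rewrite mulrC.
rewrite (@horner_coef_wide _ m.+2) ?size_take_poly // big_ord_recr /=.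
rewrite coef_take_poly ltnSn c2 mulrC big1 ?add0r // => k _.
rewrite coef_take_poly (leqW (ltn_ord k : (k < m.+1)%N)).
have := ltn_ord k; rewrite ltnS leq_eqVlt => /orP[/eqP ->|/c0 ->]; last by rewrite mul0r.
by rewrite c1 am mul0r.
Qed.

Lemma arc_poly_eqmodX k a J u z z' :
  (forall i, eqmodX k (z i) (z' i)) ->
  forall l, eqmodX k (arc_poly polyC a J u z)`_l (arc_poly polyC a J u z')`_l.
Proof.
move=> e; pose E G G' := forall l, eqmodX k G`_l G'`_l.
have ED G1 G1' G2 G2' : E G1 G1' -> E G2 G2' -> E (G1 + G2) (G1' + G2').
  by move=> e1 e2 l; rewrite !coefD; apply: eqmodXD.
have EM G1 G1' G2 G2' : E G1 G1' -> E G2 G2' -> E (G1 * G2) (G1' * G2').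
  by move=> e1 e2 l; rewrite !coefM; apply: eqmodX_sum => i; apply: eqmodXM.
rewrite -/(E _ _); apply: (big_ind2 E) => [//|x1 x2 y1 y2|j _]; first exact: ED.
apply: (@mmap_homog_part_rel _ _ _ (polyC \o polyC : {rmorphism _ -> _}) E) => //.
move=> i; apply: (ED _ _ _ _) => //; apply: (EM _ _ _ _) => // -[|l];
  by rewrite !coefC //=; apply: e.
Qed.

Lemma arc_remainder_eqmodX k a m J u z z' :
  (forall i, eqmodX k (z i) (z' i)) ->
  eqmodX k (arc_remainder a m J u z) (arc_remainder a m J u z').
Proof.
move=> e; apply: eqmodX_horner => l; rewrite !coef_drop_poly.
exact: arc_poly_eqmodX.
Qed.

(** The added terms are multiples of s^J; dropping m + 2 coefficients and setting s = t leaves a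
    multiple of t^(J - m - 2). *)
Lemma arc_remainder_extend k a m J J' u z :
  (m.+2 + k <= J)%N -> (J <= J')%N ->
  eqmodX k (arc_remainder a m J' u z) (arc_remainder a m J u z).
Proof.
move=> leJ leJ'; have [G eG] := arc_poly_extend polyC a u z leJ'.
rewrite /arc_remainder eG drop_polyD drop_polyMXn hornerD hornerM hornerXn.
apply: (@eqmodX_leq (J - m.+2)).
  by rewrite leq_subRL // (leq_trans _ leJ) ?leq_addr.
exact: eqmodX_XnM.
Qed.

(** The bound involves r0 but not r: coefficients in s are dropped at radius r0, and only then is s
    replaced by t, whose norm is at most r <= r0. *)
Lemma arc_remainder_norm a m J u z D rho r r0 R S :
  (forall i, `|u i| <= D) -> (forall i, pnorm (fun x => `|x|) r (z i) <= rho) ->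
  0 <= D -> 0 <= rho -> 0 <= r <= r0 -> 0 < r0 <= 1 -> r0 * (D + rho) <= R ->
  (forall J, \sum_(j < J) R ^+ j * l1 a j <= S) ->
  pnorm (fun x => `|x|) r (arc_remainder a m J u z) <= S / r0 ^+ m.+2.
Proof.
move=> uD zrho D0 rho0 /andP[r_ge0 rr0] /andP[r0_gt0 r0_le1] hR RS.
have hN := submult_norm (K := K); have hP := submult_pnorm hN r_ge0.
have r00 := ltW r0_gt0.
rewrite ler_pdivlMr ?exprn_gt0 // mulrC.
apply: (@le_trans _ _ (pnorm (pnorm (fun x : K => `|x|) r) r0 (arc_poly polyC a J u z))).
  apply: le_trans (pnorm_drop hP m.+2 _ r00); rewrite ler_wpM2l ?exprn_ge0 //.
  apply: (le_trans (submult_horner hP _ _)); apply: (ler_pnorm hP).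
    exact: (submult_ge0 hP).
  by apply: le_trans rr0; apply: pnormX.
apply: (arc_poly_norm (phi := polyC) J hP _ uD zrho) RS => //.
  by move=> c; rewrite /= pnormC.
by rewrite r00.
Qed.

End ArcRemainder.

(** * The formal arc *)

Section FormalArc.
Context {K : numFieldType}.
Implicit Types (r : K) (q : {poly K}).

Lemma pnormN r q : pnorm Num.norm r (- q) = pnorm Num.norm r q.
Proof.
have hN := submult_norm (K := K).
rewrite (pnormE (M := size q) hN) ?size_polyN // (pnormE (M := size q) hN) //.
by apply: eq_bigr => k _; rewrite coefN normrN.
Qed.

Context {n p : nat}.
Implicit Types (a : 'I_p -> multinom n -> K) (m : 'I_p -> nat).

Section Picard.
Variables (a : 'I_p -> multinom n -> K) (m : 'I_p -> nat).
Variables (u w : 'I_n -> K) (B : 'M[K]_(n, p)).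

Definition arc_param (y : 'I_p -> {poly K}) l : {poly K} :=
  (w l)%:P + \sum_(i < p) (B l i)%:P * y i.

(* Step N uses the series truncated at order m + 2 + N, which is exact modulo
   t^N in the remainder. *)
Fixpoint picard (N : nat) : 'I_p -> {poly K} :=
  if N is N'.+1 then fun i =>
    - ('X * arc_remainder (a i) (m i) ((m i).+2 + N) u (arc_param (picard N')))
  else fun=> 0.

Lemma picardS N i : picard N.+1 i =
  - ('X * arc_remainder (a i) (m i) ((m i).+2 + N.+1) u (arc_param (picard N))).
Proof. by []. Qed.

(** The factor t of the Picard map gains one order of agreement per step. *)
Lemma picard_eqmodX N i : eqmodX N.+1 (picard N.+1 i) (picard N i).
Proof.
elim: N i => [|N IHN] i.
  by move=> j; rewrite ltnS leqn0 => /eqP ->; rewrite picardS coefN coefXM oppr0 coef0.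
move=> [|j] lt_jN; first by rewrite !picardS !coefN !coefXM.
rewrite 2!picardS !coefN !coefXM [_.+1.-1]/= [_.+1 == 0%N]/=; congr (- _).
rewrite ltnS in lt_jN.
have hz l : eqmodX N.+1 (arc_param (picard N.+1) l) (arc_param (picard N) l).
  apply: eqmodXD => //; apply: eqmodX_sum => k; apply: eqmodXM => //; exact: IHN.
(* The argument is changed at a fixed truncation order; [e2] then lowers that order by one. *)
have e1 := arc_remainder_eqmodX (a i) (m i) ((m i).+2 + N.+2) u hz lt_jN.
have le1 : ((m i).+2 + N.+1 <= (m i).+2 + N.+1)%N by [].
have le2 : ((m i).+2 + N.+1 <= (m i).+2 + N.+2)%N by rewrite leq_add2l.
have e2 := arc_remainder_extend (a i) u (arc_param (picard N)) le1 le2 lt_jN.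
exact: etrans e1 e2.
Qed.

End Picard.

(** The last two conclusions work together: a polynomial that vanishes modulo t^J and has norm at
    most S is bounded by S / 2^J for |t| <= r / 2, uniformly in N. *)
Lemma formal_arc a m (u w : 'I_n -> K) (B : 'M[K]_(n, p)) (R S : K) :
  0 < R -> (forall i J, \sum_(j < J) R ^+ j * l1 (a i) j <= S) -> 0 <= S ->
  (forall i j, (j < m i)%N -> homog_part (a i) j = 0) ->
  (forall i, meval u (homog_part (a i) (m i)) = 0) ->
  (forall i, meval u (homog_part (a i) (m i).+1) +
     \sum_(l < n) meval u (mderiv l (homog_part (a i) (m i))) * w l = 0) ->
  (forall i k, \sum_(l < n) meval u (mderiv l (homog_part (a i) (m i))) * B l k
     = (i == k)%:R) ->
  exists r T (Z : nat -> 'I_n -> {poly K}),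
  [/\ 0 < r, forall l N, pnorm Num.norm r (Z N l) <= T,
      forall l N, eqmodX N.+1 (Z N.+1 l) (Z N l) /\ (Z N l)`_0 = w l,
      forall i J N, (J <= N)%N -> eqmodX J (arc_poly polyC (a i) J u (Z N)).['X] 0 &
      forall i J N, pnorm Num.norm r (arc_poly polyC (a i) J u (Z N)).['X] <= S].
Proof.
move=> R0 RS S0 a0 am am1 aB.
pose D := \sum_l `|u l|; pose W := \sum_l `|w l|; pose b := \sum_l \sum_i `|B l i|.
have D0 : 0 <= D by apply: sumr_ge0.
have W0 : 0 <= W by apply: sumr_ge0.
have b0 : 0 <= b by apply: sumr_ge0 => l _; apply: sumr_ge0.
(* Bounds the norm of w + B y as long as the entries of y have norm at most 1. *)
pose T := W + b; have T0 : 0 <= T by rewrite addr_ge0.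
have [r0 [r0_gt0 r0_le1 r0R]] := exists_radius R0 (addr_ge0 D0 T0).
pose C := \sum_i S / r0 ^+ (m i).+2.
have C0 : 0 <= C by apply: sumr_ge0 => i _; rewrite divr_ge0 ?exprn_ge0 // ltW.
(* Ensures r <= r0 and r C <= 1, so that the Picard step preserves the unit ball. *)
pose r := r0 / (1 + C).
have C1 : 0 < 1 + C by rewrite ltr_wpDr.
have r_gt0 : 0 < r by rewrite divr_gt0.
have r_r0 : r <= r0 by rewrite ler_pdivrMr // ler_peMr ?(ltW r0_gt0) // lerDl.
have rC : r * C <= 1.
  rewrite mulrAC ler_pdivrMr // mul1r; apply: (@le_trans _ _ C); last by rewrite lerDr.
  by rewrite ler_piMl.
have uD l : `|u l| <= D.
  by rewrite /D (bigD1 l) //= lerDl sumr_ge0.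
have hN := submult_norm (K := K); have hP := submult_pnorm hN (ltW r_gt0).
pose y := picard a m u w B; pose Z N := arc_param w B (y N).
have ZT N : (forall i, pnorm Num.norm r (y N i) <= 1) ->
    forall l, pnorm Num.norm r (Z N l) <= T.
  move=> hy l; apply: (le_trans (submultD hP _ _)); apply: lerD.
    by rewrite (pnormC hN) /W (bigD1 l) //= lerDl sumr_ge0.
  apply: (le_trans (submult_sum hP _ _ _)).
  apply: (@le_trans _ _ (\sum_i `|B l i|)).
    apply: ler_sum => i _; apply: (le_trans (submultM hP _ _)).
    by rewrite (pnormC hN) ler_piMr.
  by rewrite /b (bigD1 l) //= lerDl sumr_ge0 // => k _; apply: sumr_ge0.
have y1 N i : pnorm Num.norm r (y N i) <= 1.
  elim: N i => [|N IHN] i; first by rewrite (submult0 hP).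
  rewrite pnormN; apply: le_trans rC; rewrite -['X]expr1 (pnormXnM hN) expr1.
  rewrite ler_wpM2l ?(ltW r_gt0) //.
  apply: le_trans (_ : S / r0 ^+ (m i).+2 <= C).
    apply: (@arc_remainder_norm _ _ _ _ _ u _ D T r r0 R S uD (ZT _ IHN)) => //.
      by rewrite ltW.
    by rewrite r0_gt0.
  rewrite /C (bigD1 i) //= lerDl sumr_ge0 // => k _.
  by rewrite divr_ge0 ?exprn_ge0 // ltW.
exists r, T, Z; split=> //.
- by move=> l N; apply: ZT.
- move=> l N; split.
    apply: eqmodXD => //; apply: eqmodX_sum => i; apply: eqmodXM => //.
    exact: picard_eqmodX.
  rewrite /Z /arc_param coefD coefC coef_sum big1 ?addr0 // => i _.
  (* Every iterate is divisible by t, so B y leaves the constant term w unchanged. *)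
  have -> : (y N i) = 'X * (drop_poly 1 (y N i)).
    rewrite mulrC -['X]expr1 -{1}(poly_take_drop 1 (y N i)).
    suff -> : take_poly 1 (y N i) = 0 by rewrite add0r.
    apply/polyP => -[|j]; rewrite coef_take_poly coef0 //=.
    by case: (N) => [|N']; rewrite ?coef0 // coefN coefXM oppr0.
  by rewrite mulrCA coefXM.
- move=> i J N leJN.
  (* At the truncation order of Picard step N + 1, the arc polynomial is t^(m+1) (y_N + t H) =
     t^(m+1) (y_N - y_(N+1)), which vanishes modulo t^(N+1). *)
  have leJ' : (J <= (m i).+2 + N.+1)%N.
    by rewrite (leq_trans leJN) // (leq_trans (leqnSn N)) // leq_addl.
  have [G eG] := arc_poly_extend polyC (a i) u (Z N) leJ'.
  have {eG} : (arc_poly polyC (a i) ((m i).+2 + N.+1) u (Z N)).['X] =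
      (arc_poly polyC (a i) J u (Z N)).['X] + G.['X] * 'X^J.
    by rewrite eG hornerD hornerM hornerXn.
  rewrite (@arc_poly_remainder _ _ (a i) (m i)) ?leq_addr //; last by move=> j; apply: a0.
  have eL : (meval u (homog_part (a i) (m i).+1))%:P +
      \sum_(l < n) (meval u (mderiv l (homog_part (a i) (m i))))%:P * Z N l = y N i.
    under eq_bigr do rewrite /Z /arc_param mulrDr mulr_sumr.
    rewrite big_split /= addrA.
    have -> : (meval u (homog_part (a i) (m i).+1))%:P +
      \sum_(l < n) (meval u (mderiv l (homog_part (a i) (m i))))%:P * (w l)%:P = 0.
      under eq_bigr do rewrite -polyCM.
      by rewrite -rmorph_sum -polyCD /= am1.
    rewrite add0r exchange_big /=.
    under [LHS]eq_bigr => k _.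
      under eq_bigr => l _ do rewrite mulrA -polyCM.
      rewrite -mulr_suml -rmorph_sum aB; over.
    rewrite (bigD1 i) //= eqxx mul1r big1 ?addr0 // => k neq_ki.
    by rewrite eq_sym (negbTE neq_ki) mul0r.
  rewrite eL => eJ j lt_jJ.
  have := @eqmodX_XnM _ J (arc_poly polyC (a i) J u (Z N)).['X] (G.['X]) j lt_jJ.
  rewrite -eJ => <-; rewrite coefXnM coef0; case: ltnP => // le_mj.
  have -> : 'X * arc_remainder (a i) (m i) ((m i).+2 + N.+1) u (Z N) = - y N.+1 i.
    by rewrite opprK.
  rewrite coefB (_ : (y N.+1 i)`_(j - (m i).+1) = (y N i)`_(j - (m i).+1)) ?subrr //.
  apply: picard_eqmodX.
  by rewrite ltnS (leq_trans (leq_subr _ _)) // (leq_trans (ltnW lt_jJ)).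
- move=> i J N; apply: (le_trans (submult_horner hP _ _)).
  apply: (@le_trans _ _ (pnorm (pnorm Num.norm r) r0 (arc_poly polyC (a i) J u (Z N)))).
    apply: (ler_pnorm hP); first exact: (submult_ge0 hP).
    by apply: le_trans r_r0; apply: (pnormX hN); apply: ltW.
  apply: (@arc_poly_norm _ _ _ polyC (pnorm Num.norm r) (a i) J u (Z N)
    D T r0 R S hP) => //.
  - by move=> c; rewrite (pnormC hN).
  - by move=> l; apply: ZT.
  - by rewrite ltW.
Qed.

End FormalArc.

(** * Limits and power series at 0 *)

Section NumFieldLimits.
Context {K : numFieldType}.

Lemma cvgn_unique (u : nat -> K) (a b : K) :
  u @ \oo --> a -> u @ \oo --> b -> a = b.
Proof. by move=> ua ub; apply: (cvg_unique (@norm_hausdorff K K) ua ub). Qed.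

Lemma cvgn_norm_le (u : nat -> K) l b :
  u @ \oo --> l -> (\forall k \near \oo, `|u k| <= b) -> `|l| <= b.
Proof.
move=> /cvgrPdist_lt ul ub.
(* The order of K is partial; b is real because it dominates a norm. *)
have b_real : b \is Num.real.
  have [k _ /(_ k (leqnn _)) uk] := ub.
  by apply: ger0_real; apply: le_trans uk.
rewrite real_leNgt ?normr_real //; apply/negP => lt_bl.
have e0 : 0 < `|l| - b by rewrite subr_gt0.
have [k1 _ h1] := ul _ e0; have [k2 _ h2] := ub.
have {}h1 := h1 (maxn k1 k2) (leq_maxl _ _).
have {}h2 := h2 (maxn k1 k2) (leq_maxr _ _).
have : `|l| < `|l| - b + b.
  apply: le_lt_trans (ltr_leD h1 h2).
  by rewrite -{1}(subrK (u (maxn k1 k2)) l) ler_normD.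
by rewrite subrK ltxx.
Qed.

Lemma cvgn_squeeze0 (u v : nat -> K) C :
  (\forall k \near \oo, `|u k| <= C * `|v k|) -> v @ \oo --> (0 : K) ->
  u @ \oo --> (0 : K).
Proof.
move=> uv /cvgr0Pnorm_lt v0; apply/cvgr0Pnorm_lt => e e0.
have C0 : 0 < `|C| + 1 by rewrite ltr_wpDl.
have : \forall k \near \oo, `|v k| < e / (`|C| + 1) by apply: v0; rewrite divr_gt0.
apply: filterS2 uv => k le_uv; rewrite ltr_pdivlMr // => lt_ve.
apply: le_lt_trans lt_ve; apply: (le_trans le_uv).
have C_real : C * `|v k| \is Num.real.
  by apply: ger0_real; apply: le_trans le_uv.
apply: (le_trans (real_ler_norm C_real)).
by rewrite normrM normr_id mulrC ler_wpM2l // lerDl.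
Qed.

Lemma nondecreasing_cvgn_bounded (u : nat -> K) :
  (forall k, 0 <= u k) -> {homo u : j k / (j <= k)%N >-> j <= k} -> cvgn u ->
  exists2 S, 0 <= S & forall k, u k <= S.
Proof.
move=> u0 umono /cvg_ex[l /cvgrPdist_lt/(_ 1 ltr01)[k0 _ h]].
exists (`|l| + 1) => [|k]; first by rewrite addr_ge0.
have {}h := h (maxn k0 k) (leq_maxl _ _).
apply: (le_trans (umono _ _ (leq_maxr k0 k))).
rewrite -(ger0_norm (u0 (maxn k0 k))) -(subrK l (u _)).
by rewrite addrC (le_trans (ler_normD _ _)) // lerD2l distrC ltW.
Qed.

Lemma row_ballP n (x y : 'rV[K]_n) e : 0 < e ->
  ball x e y <-> forall i, `|x 0 i - y 0 i| < e.
Proof.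
move=> e0; split=> [[_ h] i|h]; first by have := h 0 i; rewrite -ball_normE.
by split=> // i j; rewrite -ball_normE /= ord1.
Qed.

Lemma near_row0P n (P : 'rV[K]_n -> Prop) :
  (\forall x \near (0 : 'rV[K]_n), P x) <->
  exists2 e : K, 0 < e & forall x : 'rV[K]_n, (forall i, `|x 0 i| < e) -> P x.
Proof.
split=> [/nbhs_ballP[e e0 h]|[e e0 h]].
  exists e => // x hx; apply: h; apply/row_ballP => // i.
  by rewrite mxE sub0r normrN.
apply/nbhs_ballP; exists e => // x /(row_ballP _ _ e0) hx; apply: h => i.
by have := hx i; rewrite mxE sub0r normrN.
Qed.

Lemma cvg_rowP n T {F : set_system T} {FF : Filter F} (x : T -> 'rV[K]_n)
    (l : 'rV[K]_n) :
  x @ F --> l <-> forall i, (fun t => x t 0 i) @ F --> l 0 i.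
Proof.
split=> [h i|h].
  exact: (cvg_comp x (fun M : 'rV[K]_n => M 0 i) h (@coord_continuous K 1 n 0 i l)).
move=> A /nbhs_ballP[e e0 hA].
have : \forall t \near F, forall i : 'I_n, `|l 0 i - x t 0 i| < e.
  by apply: filter_forall => i; have /cvgrPdist_lt := h i; apply.
by apply: filterS => t ht; apply: hA; apply/row_ballP.
Qed.

Lemma meval_cvg n T (F : set_system T) (FF : Filter F) (x : T -> 'I_n -> K)
    (l : 'I_n -> K) (P : mpoly n K) :
  (forall i, x ^~ i @ F --> l i) -> (fun t => meval (x t) P) @ F --> meval l P.
Proof.
move=> xl; rewrite mevalE; under eq_fun do rewrite mevalE.
apply: cvg_big => [|m _]; first exact: add_continuous.
apply: cvgM; first exact: cvg_cst.
apply: cvg_big => [|i _]; first exact: mul_continuous.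
elim: (m i) => [|k IHk]; first by apply: cvg_cst.
by under eq_fun do rewrite exprS; rewrite exprS; apply: cvgM.
Qed.

Lemma pnorm_tail (q : {poly K}) r x N : 0 <= r -> `|x| <= r ->
  `|q.[x] - \sum_(k < N) q`_k * x ^+ k| * r ^+ N <= `|x| ^+ N * pnorm Num.norm r q.
Proof.
move=> r0 xr; have hN := submult_norm (K := K).
have -> : q.[x] - \sum_(k < N) q`_k * x ^+ k = (drop_poly N q).[x] * x ^+ N.
  rewrite -{1}(poly_take_drop N q) hornerD hornerM hornerXn.
  rewrite (@horner_coef_wide _ N (take_poly N q)) ?size_take_poly //.
  under eq_bigr do rewrite coef_take_poly ltn_ord.
  by rewrite addrC addrA addNr add0r.
rewrite normrM normrX mulrAC [leLHS]mulrC ler_wpM2l ?exprn_ge0 //.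
apply: le_trans (pnorm_drop hN N q r0); rewrite mulrC ler_wpM2l ?exprn_ge0 //.
by apply: (le_trans (submult_horner hN _ _)); apply: (ler_pnorm hN).
Qed.

End NumFieldLimits.

(** * Analytic germs on a polydisc and their expansion along arcs *)

Section PowerSeriesAtZero.
Context {K : numFieldType} {n : nat}.
Implicit Types (f : 'rV[K]_n -> K) (a : multinom n -> K).

Record series_data f a (R S : K) : Prop := SeriesData {
  radius_gt0 : 0 < R;
  bound_ge0 : 0 <= S;
  series_bound : forall J, \sum_(j < J) R ^+ j * l1 a j <= S;
  series_cvg : forall x : 'rV[K]_n, (forall i, `|x 0 i| <= R) ->
    (fun J => \sum_(j < J) meval (x 0) (homog_part a j)) @ \oo --> f x }.

Lemma power_series_data f a : power_series_at 0 f a ->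
  exists R S, series_data f a R S.
Proof.
move=> /near_row0P[e e0 h]; pose R := e / 2.
have R0 : 0 < R by rewrite divr_gt0.
have Re : R < e by rewrite ltr_pdivrMr // ltr_pMr // ltr1n.
pose u J := \sum_(j < J) R ^+ j * l1 a j.
have [S S0 hS] : exists2 S, 0 <= S & forall J, u J <= S.
  apply: nondecreasing_cvgn_bounded.
  - by move=> J; apply: sumr_ge0 => j _; rewrite mulr_ge0 ?l1_ge0 // exprn_ge0 // ltW.
  - move=> J J' leJ; rewrite /u -(subnKC leJ) big_split_ord /= lerDl.
    by apply: sumr_ge0 => j _; rewrite mulr_ge0 ?l1_ge0 // exprn_ge0 // ltW.
  (* At the corner of the polydisc the series of absolute values is exactly the majorant [u]. *)
  have hR (i : 'I_n) : `|(const_mx R : 'rV[K]_n) 0 i| < e by rewrite mxE gtr0_norm.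
  move: (h _ hR) => /= [+ _].
  rewrite (_ : series _ = u) //; apply/funext => J.
  rewrite /u seriesEord; apply: eq_bigr => j _ /=.
  rewrite [LHS](mmap_homog_part idfun) /l1 mulr_sumr; apply: eq_bigr => m /eqP deg_m.
  rewrite mulrC; congr (_ * _); under eq_bigr do rewrite !mxE subr0 gtr0_norm //.
  by rewrite prodrXr -mdegE deg_m.
exists R, S; split=> // x hx.
have xe i : `|x 0 i| < e by apply: le_lt_trans Re.
move: (h _ xe) => /= [_].
by rewrite subr0 seriesEord.
Qed.

Lemma series_data_shrink f a R S R' S' : 0 < R' -> R' <= R -> S <= S' ->
  series_data f a R S -> series_data f a R' S'.
Proof.
move=> R'0 R'R SS' [R0 S0 hS hf]; split=> // [|J|x hx].
- exact: le_trans SS'.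
- apply: le_trans SS'; apply: le_trans (hS J); apply: ler_sum => j _.
  by rewrite ler_wpM2r ?l1_ge0 // lerXn2r // nnegrE ltW.
- by apply: hf => i; apply: le_trans R'R.
Qed.

Lemma taylorP f : analytic_germ f -> power_series_at 0 f (taylor f).
Proof. by move=> /nbhs_singleton h; apply: xgetPex. Qed.

Lemma order0P f j : component f j != 0 ->
  component f (order0 f) != 0 /\ forall i, (i < order0 f)%N -> component f i = 0.
Proof.
move=> fj; apply: (@xgetPex _ 0%N [set m | component f m != 0 /\
  forall i, (i < m)%N -> component f i = 0]).
have [m fm min_m] := ex_minnP (ex_intro (fun j => component f j != 0) j fj).
exists m; split=> // i lt_im; apply/eqP; apply: contraTT lt_im => /min_m.
by rewrite -leqNgt.
Qed.

(** Uniformity in u is what lets the direction vary with the point, as it does for tangent cone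
    sequences. The constant is the tail bound of [pnorm_tail] at order m + 2, passed to the limit in
    J. *)
Lemma arc_estimate f a R S m D rho : series_data f a R S ->
  (forall j, (j < m)%N -> homog_part a j = 0) -> 0 <= D -> 0 <= rho ->
  exists r0 C, 0 < r0 /\ forall t (u z : 'I_n -> K) (x : 'rV[K]_n), `|t| <= r0 ->
    (forall i, `|u i| <= D) -> (forall i, `|z i| <= rho) ->
    (forall i, x 0 i = u i * t + z i * t ^+ 2) ->
    `|f x - t ^+ m * (meval u (homog_part a m) + t * (meval u (homog_part a m.+1)
        + \sum_(i < n) meval u (mderiv i (homog_part a m)) * z i))|
      <= C * `|t| ^+ m.+2.
Proof.
move=> [R0 S0 hS hf] a0 D0 rho0.
have hN := submult_norm (K := K).
have [r0 [r0_gt0 r0_le1 r0R]] := exists_radius R0 (addr_ge0 D0 rho0).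
have r0_ge0 := ltW r0_gt0.
exists r0, (S / r0 ^+ m.+2); split=> // t u z x tr uD zrho xE.
pose G J := arc_poly (idfun : {rmorphism K -> K}) a J u z.
have GS J : pnorm Num.norm r0 (G J) <= S.
  by apply: (arc_poly_norm (phi := idfun) J hN _ uD zrho) hS => //; rewrite r0_ge0.
have GE J : (G J).[t] = \sum_(j < J) meval (x 0) (homog_part a j).
  rewrite /G arc_poly_horner; apply: eq_bigr => j _.
  by apply: meval_eq => i; rewrite xE.
have xR i : `|x 0 i| <= R.
  rewrite xE; apply: (le_trans (ler_normD _ _)); rewrite !normrM.
  apply: le_trans r0R; rewrite mulrDr; apply: lerD; rewrite mulrC; apply: ler_pM => //.
    by rewrite mulr_ge0.
  by apply: (le_trans _ tr); rewrite ler_piMr // (le_trans tr).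
apply: (@cvgn_norm_le _ (fun J => (G J).[t] - t ^+ m * (meval u (homog_part a m) +
    t * (meval u (homog_part a m.+1)
        + \sum_(i < n) meval u (mderiv i (homog_part a m)) * z i)))).
  apply: cvgB; last exact: cvg_cst.
  by under eq_fun do rewrite GE; apply: hf.
exists m.+2 => // J /= leJ.
have [c0 c1 c2] := arc_poly_coef (idfun : {rmorphism K -> K}) u z a0 leJ.
have := pnorm_tail (G J) m.+2 r0_ge0 tr.
have -> : \sum_(k < m.+2) (G J)`_k * t ^+ k = t ^+ m * (meval u (homog_part a m) +
    t * (meval u (homog_part a m.+1)
        + \sum_(i < n) meval u (mderiv i (homog_part a m)) * z i)).
  rewrite !big_ord_recr /= big1 => [|k _]; last by rewrite c0 ?mul0r.
  rewrite add0r c1 c2 /= exprS mulrDr mulrC; congr (_ + _).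
  by rewrite mulrCA mulrA mulrC mulrA.
move=> le_tail; rewrite mulrAC ler_pdivlMr ?exprn_gt0 //; apply: (le_trans le_tail).
by rewrite mulrC ler_wpM2r ?exprn_ge0.
Qed.

(** Dividing [arc_estimate] by s_k^m gives f_m(u) = 0 in the limit. A second division by s_k
    requires f_m(v_k) = 0, which a constant direction guarantees. *)
Lemma arc_initial_terms f a R S m (s : nat -> K) (v z : nat -> 'I_n -> K)
    (x : nat -> 'rV[K]_n) (u z0 : 'I_n -> K) : series_data f a R S ->
  (forall j, (j < m)%N -> homog_part a j = 0) ->
  (forall k, 0 < s k) -> s @ \oo --> (0 : K) ->
  (forall i, v ^~ i @ \oo --> u i) -> (forall i, z ^~ i @ \oo --> z0 i) ->
  (forall k i, x k 0 i = v k i * s k + z k i * s k ^+ 2) ->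
  (\forall k \near \oo, f (x k) = 0) ->
  meval u (homog_part a m) = 0 /\
  ((forall k, v k = u) -> meval u (homog_part a m.+1)
     + \sum_(i < n) meval u (mderiv i (homog_part a m)) * z0 i = 0).
Proof.
move=> hfa a0 s0 s_cvg v_cvg z_cvg xE fx0.
have sum_ge0 (y : 'I_n -> K) : 0 <= \sum_i `|y i| + 1.
  by rewrite addr_ge0 // sumr_ge0.
have [r0 [C [r0_gt0 est]]] := arc_estimate hfa a0 (sum_ge0 u) (sum_ge0 z0).
have near_le (y : nat -> 'I_n -> K) (y0 : 'I_n -> K) :
    (forall i, y ^~ i @ \oo --> y0 i) ->
    \forall k \near \oo, forall i, `|y k i| <= \sum_i `|y0 i| + 1.
  move=> y_cvg; apply: filter_forall => i.
  have /cvgrPdist_le/(_ 1 ltr01) := y_cvg i; apply: filterS => k hk.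
  rewrite -(subrK (y0 i) (y k i)) addrC (le_trans (ler_normD _ _)) // distrC lerD //.
  by rewrite (bigD1 i) //= lerDl sumr_ge0.
pose b k := meval (v k) (homog_part a m.+1)
     + \sum_(i < n) meval (v k) (mderiv i (homog_part a m)) * z k i.
have b_cvg : b @ \oo --> meval u (homog_part a m.+1)
     + \sum_(i < n) meval u (mderiv i (homog_part a m)) * z0 i.
  apply: cvgD; first exact: meval_cvg.
  apply: cvg_big => [|i _]; first exact: add_continuous.
  by apply: cvgM => //; apply: meval_cvg.
have bnd : \forall k \near \oo,
    `|meval (v k) (homog_part a m) + s k * b k| <= C * `|s k| ^+ 2.
  have s_le : \forall k \near \oo, `|s k| <= r0 by apply: cvgr0_norm_le.
  have v_le := near_le _ _ v_cvg; have z_le := near_le _ _ z_cvg.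
  near=> k.
  have fxk : f (x k) = 0 by near: k.
  have sk : `|s k| <= r0 by near: k.
  have vk : forall i, `|v k i| <= \sum_i `|u i| + 1 by near: k.
  have zk : forall i, `|z k i| <= \sum_i `|z0 i| + 1 by near: k.
  have := est (s k) (v k) (z k) (x k) sk vk zk (xE k).
  rewrite fxk sub0r normrN normrM normrX -addn2 exprD mulrCA.
  by rewrite ler_pM2l // exprn_gt0 // normr_gt0 gt_eqF.
have fm0 : meval u (homog_part a m) = 0.
  have cvg1 : (fun k => meval (v k) (homog_part a m) + s k * b k) @ \oo -->
      meval u (homog_part a m) + 0 * (meval u (homog_part a m.+1)
     + \sum_(i < n) meval u (mderiv i (homog_part a m)) * z0 i).
    by apply: cvgD; [apply: meval_cvg|apply: cvgM].
  have cvg2 : (fun k => meval (v k) (homog_part a m) + s k * b k) @ \oo --> (0 : K).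
    apply: (@cvgn_squeeze0 _ _ (fun k => s k ^+ 2) C).
      by apply: filterS bnd => k; rewrite normrX.
    have <- : (0 : K) * 0 = 0 by rewrite mul0r.
    by under eq_fun do rewrite expr2; apply: cvgM.
  by have := cvgn_unique cvg1 cvg2; rewrite mul0r addr0.
split=> // vu.
apply: (cvgn_unique b_cvg); apply: (@cvgn_squeeze0 _ _ s C) => //.
apply: filterS bnd => k; rewrite vu fm0 add0r normrM expr2 mulrCA.
by rewrite ler_pM2l // normr_gt0 gt_eqF.
Unshelve. all: by end_near. Qed.

End PowerSeriesAtZero.

(** * Convergence of the arc *)

(** An Archimedean condition, which makes powers of 1/2 tend to 0, and completeness in the form of
    convergence of absolutely convergent series. *)
Definition complete_field (K : numFieldType) : Prop :=
  (fun k => k.+1%:R^-1) @ \oo --> (0 : K) /\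
  forall a : nat -> K, (exists M, forall N, \sum_(k < N) `|a k| <= M) ->
    exists l : K, (fun N => \sum_(k < N) a k) @ \oo --> l.

Section AnalyticArc.
Context {K : numFieldType} (hK : complete_field K).

Lemma half_expn_cvg : (fun N => 2^-1 ^+ N) @ \oo --> (0 : K).
Proof.
apply: (@cvgn_squeeze0 _ _ (fun k => k.+1%:R^-1) 1); last by case: hK.
exists 0%N => // k _; rewrite mul1r ger0_norm ?exprn_ge0 ?invr_ge0 //.
rewrite ger0_norm ?invr_ge0 // exprVn lef_pV2 ?posrE ?exprn_gt0 //.
by rewrite -natrX ler_nat ltn_expl.
Qed.

Lemma half_expn_bound_cvg (u : nat -> K) (l T : K) :
  (forall N, `|l - u N| <= 2^-1 ^+ N * T) -> u @ \oo --> l.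
Proof.
move=> h; have d0 : (fun N => l - u N) @ \oo --> (0 : K).
  apply: (cvgn_squeeze0 (C := T)) half_expn_cvg.
  exists 0%N => // N _.
  by rewrite mulrC (le_trans (h N)) // ger0_norm ?exprn_ge0 ?invr_ge0.
rewrite (_ : u = fun N => l - (l - u N)); last first.
  by apply/funext => N; rewrite opprB addrC subrK.
by rewrite -[X in _ --> X](subr0 l); apply: cvgB => //; apply: cvg_cst.
Qed.

Lemma pnorm_tail_half (q : {poly K}) r x N : 0 < r -> `|x| <= r / 2 ->
  `|q.[x] - \sum_(k < N) q`_k * x ^+ k| <= 2^-1 ^+ N * pnorm Num.norm r q.
Proof.
move=> r0 xr; have r_ge0 := ltW r0.
have xr' : `|x| <= r by apply: (le_trans xr); rewrite ler_pdivrMr // ler_pMr // ler1n.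
rewrite -(@ler_pM2r _ (r ^+ N)) ?exprn_gt0 //.
apply: (le_trans (pnorm_tail q N r_ge0 xr')).
have hP := submult_pnorm (submult_norm (K := K)) r_ge0.
rewrite mulrAC -exprMn ler_wpM2r ?(submult_ge0 hP) //.
by rewrite lerXn2r ?nnegrE ?mulr_ge0 ?invr_ge0 // mulrC.
Qed.

Section PolynomialLimit.
Variables (P : nat -> {poly K}) (r T : K).
Hypotheses (r0 : 0 < r) (PT : forall N, pnorm Num.norm r (P N) <= T).
Hypothesis P_eq : forall N, eqmodX N.+1 (P N.+1) (P N).

Lemma stable_coef k N : (k <= N)%N -> (P N)`_k = (P k)`_k.
Proof.
move=> /subnK <-; elim: (N - k)%N => [//|d IHd].
by rewrite addSn P_eq // ltnS leq_addl.
Qed.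

Lemma stable_coef_bound N : \sum_(k < N) `|(P k)`_k| * r ^+ k <= T.
Proof.
apply: le_trans (PT N).
apply: le_trans (pnorm_partial_sum (submult_norm (K := K)) (P N) N (ltW r0)).
by apply: ler_sum => k _; rewrite stable_coef // ltnW.
Qed.

(** The coefficients of [P N] up to degree N are final and its tail is at most T / 2^N, so both
    limits agree. The polynomials serve to verify the equations, the diagonal series to prove
    analyticity. *)
Lemma stable_coef_cvg t : `|t| <= r / 2 -> exists l : K,
  (fun N => \sum_(k < N) (P k)`_k * t ^+ k) @ \oo --> l /\
  (fun N => (P N).[t]) @ \oo --> l.
Proof.
move=> tr; case: (hK) => _ /(_ (fun k => (P k)`_k * t ^+ k))[|l hl].
  exists T => N; apply: (le_trans _ (stable_coef_bound N)).
  apply: ler_sum => k _; rewrite normrM normrX ler_wpM2l //.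
  rewrite lerXn2r ?nnegrE ?(ltW r0) // (le_trans tr) // ler_pdivrMr //.
  by rewrite ler_pMr // ler1n.
exists l; split=> //.
have d0 : (fun N => (P N).[t] - \sum_(k < N) (P k)`_k * t ^+ k) @ \oo --> (0 : K).
  apply: (cvgn_squeeze0 (C := T)) half_expn_cvg; exists 0%N => // N _.
  have := pnorm_tail_half (P N) N r0 tr.
  under eq_bigr => k _ do rewrite (stable_coef (ltnW (ltn_ord k))).
  move=> /le_trans; apply.
  by rewrite ger0_norm ?exprn_ge0 ?invr_ge0 // mulrC ler_wpM2r ?exprn_ge0 ?invr_ge0.
rewrite (_ : (fun N => (P N).[t]) = fun N => (P N).[t]
  - \sum_(k < N) (P k)`_k * t ^+ k + \sum_(k < N) (P k)`_k * t ^+ k).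
  by rewrite -[X in _ --> X](add0r l); apply: cvgD.
by apply/funext => N; rewrite subrK.
Qed.

End PolynomialLimit.

(** The partial sums, rewritten in powers of t - t0, have norm at most T at radius d because |t0| +
    d <= r. Their coefficients therefore converge, with tails controlled uniformly in L. *)
Lemma power_series_recenter (c : nat -> K) r T t0 d : 0 <= r -> 0 < d ->
  `|t0| + d <= r -> (forall N, \sum_(k < N) `|c k| * r ^+ k <= T) ->
  exists b : nat -> K, forall t (l : K), `|t - t0| <= d / 2 ->
    (fun N => \sum_(k < N) c k * t ^+ k) @ \oo --> l ->
    (fun N => \sum_(k < N) b k * (t - t0) ^+ k) @ \oo --> l.
Proof.
move=> r0 d0 tdr cT; have d_ge0 := ltW d0.
have hN := submult_norm (K := K); have hP := submult_pnorm hN d_ge0.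
pose s : {poly K} := 'X + t0%:P.
have sr : pnorm Num.norm d s <= r.
  apply: le_trans tdr; apply: (le_trans (submultD hP _ _)).
  by rewrite (pnormC hN) addrC lerD2l (pnormX hN).
have sX l : pnorm Num.norm d (s ^+ l) <= r ^+ l.
  apply: (le_trans (submultX hP _ _)).
  by rewrite lerXn2r ?nnegrE // (submult_ge0 hP).
pose Q L : {poly K} := \sum_(l < L) c l *: s ^+ l.
have QE L t : (Q L).[t] = \sum_(l < L) c l * (t + t0) ^+ l.
  rewrite /Q horner_sum; apply: eq_bigr => l _.
  by rewrite hornerZ horner_exp !hornerE.
have QT L : pnorm Num.norm d (Q L) <= T.
  apply: le_trans (cT L); apply: (le_trans (submult_sum hP _ _ _)).
  apply: ler_sum => l _; rewrite -mul_polyC; apply: (le_trans (submultM hP _ _)).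
  by rewrite (pnormC hN) ler_wpM2l.
have Qcvg k : exists b : K, (fun L => (Q L)`_k) @ \oo --> b.
  case: (hK) => _ /(_ (fun l => c l * (s ^+ l)`_k))[|b hb].
    exists (T / d ^+ k) => L; rewrite ler_pdivlMr ?exprn_gt0 // mulr_suml.
    apply: le_trans (cT L); apply: ler_sum => l _.
    rewrite normrM -mulrA ler_wpM2l //.
    by apply: le_trans (sX l); apply: (pnorm_coef hN).
  exists b; rewrite (_ : (fun L => (Q L)`_k) =
    fun L => \sum_(l < L) c l * (s ^+ l)`_k) //; apply/funext => L.
  by rewrite /Q coef_sum; apply: eq_bigr => l _; rewrite coefZ.
have [b hb] := choice Qcvg.
exists b => t l td tl; apply: (@half_expn_bound_cvg _ _ T) => N.
apply: (@cvgn_norm_le _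
  (fun L => (Q L).[t - t0] - \sum_(k < N) (Q L)`_k * (t - t0) ^+ k)).
  apply: cvgB; first by under eq_fun do rewrite QE subrK.
  apply: cvg_big => [|k _]; first exact: add_continuous.
  by apply: cvgM => //; apply: cvg_cst.
exists 0%N => // L _; apply: (le_trans (pnorm_tail_half (Q L) N d0 td)).
by rewrite ler_wpM2l ?exprn_ge0 ?invr_ge0.
Qed.

End AnalyticArc.

(** * The analytic solution curve *)

Section AnalyticSolution.
Context {K : numFieldType} (hK : complete_field K) {n p : nat}.

Lemma arc_poly_hornerX (a : multinom n -> K) J (u : 'I_n -> K)
    (z : 'I_n -> {poly K}) t :
  (arc_poly polyC a J u z).['X].[t] =
  \sum_(j < J) meval (fun l => ((u l)%:P * 'X + z l * 'X^2).[t]) (homog_part a j).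
Proof.
rewrite arc_poly_horner horner_sum; apply: eq_bigr => j _.
rewrite [meval _ _](mmap_homog_part idfun) mmap_homog_part horner_sum.
apply: eq_bigr => q _; rewrite hornerM hornerC horner_prod; congr (_ * _).
by apply: eq_bigr => l _; rewrite horner_exp.
Qed.

(** The bound d will keep the curve in the neighbourhood where X is the zero set of the f_i. *)
Lemma analytic_arc (f : 'I_p -> 'rV[K]_n -> K) a m (u w : 'rV[K]_n)
    (B : 'M[K]_(n, p)) (R S d : K) :
  0 < R -> 0 <= S -> (forall i, series_data (f i) (a i) R S) ->
  (forall i j, (j < m i)%N -> homog_part (a i) j = 0) ->
  (forall i, meval (u 0) (homog_part (a i) (m i)) = 0) ->
  (forall i, meval (u 0) (homog_part (a i) (m i).+1) +
     \sum_(l < n) meval (u 0) (mderiv l (homog_part (a i) (m i))) * w 0 l = 0) ->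
  (forall i k, \sum_(l < n) meval (u 0) (mderiv l (homog_part (a i) (m i))) * B l k
     = (i == k)%:R) ->
  0 < d ->
  exists (eps : K) (c : K -> 'rV[K]_n),
    [/\ 0 < eps,
        forall t, 0 < t < eps -> (forall i, f i (c t) = 0) /\ forall l, `|c t 0 l| < d,
        analytic_curve eps c &
        t ^- 2 *: (c t - (t *: u + t ^+ 2 *: w)) @[t --> 0^'+] --> (0 : 'rV[K]_n)].
Proof.
move=> R0 S0 hf a0 am am1 aB d0.
have hS i J : \sum_(j < J) R ^+ j * l1 (a i) j <= S by case: (hf i).
have [r [T [Z [r0 ZT ZE arc0 arcS]]]] := formal_arc R0 hS S0 a0 am am1 aB.
have r_ge0 := ltW r0.
have hN := submult_norm (K := K); have hP := submult_pnorm hN r_ge0.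
pose X l N : {poly K} := (u 0 l)%:P * 'X + Z N l * 'X^2.
pose W := (\sum_l `|u 0 l|) * r + `|T| * r ^+ 2.
have W0 : 0 <= W by rewrite addr_ge0 // mulr_ge0 ?exprn_ge0 // sumr_ge0.
have XW l N : pnorm Num.norm r (X l N) <= W.
  apply: (le_trans (submultD hP _ _)); apply: lerD.
    rewrite mulrC -['X]expr1 (pnormXnM hN) expr1 mulrC ler_wpM2r // (pnormC hN).
    by rewrite (bigD1 l) //= lerDl sumr_ge0.
  rewrite mulrC (pnormXnM hN) mulrC.
  rewrite ler_wpM2r ?exprn_ge0 //; apply: (le_trans (ZT l N)).
  by apply/real_ler_norm/ger0_real/(le_trans (submult_ge0 hP _))/(ZT l N).
have X_eq l N : eqmodX N.+1 (X l N.+1) (X l N).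
  by apply: eqmodXD => //; apply: eqmodXM => //; case: (ZE l N).
have X0 l N : (X l N)`_0 = 0 by rewrite coefD coefMX coefMXn /= addr0.
have X1 l N : (X l N)`_1 = u 0 l by rewrite coefD coefMX coefMXn coefC /= addr0.
have X2 l N : (X l N)`_2 = w 0 l.
  by rewrite coefD coefMX coefMXn coefC /= add0r; case: (ZE l N).
pose s l t N := \sum_(k < N) (X l k)`_k * t ^+ k.
pose c t : 'rV[K]_n := \row_l lim (s l t @ \oo).
have c_cvg l t : `|t| <= r / 2 ->
    s l t @ \oo --> c t 0 l /\ (fun N => (X l N).[t]) @ \oo --> c t 0 l.
  move=> tr; have [y [sy Xy]] := stable_coef_cvg hK r0 (XW l) (X_eq l) tr.
  by rewrite mxE (cvg_lim (@norm_hausdorff K K) sy).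
(* The case N = 1 bounds the size of c, the case N = 3 gives its second-order expansion. *)
have c_tail l t N : `|t| <= r / 2 -> (0 < N)%N ->
    `|c t 0 l - \sum_(k < N) (X l N)`_k * t ^+ k| * r ^+ N <= `|t| ^+ N * W.
  move=> tr N0; rewrite -ler_pdivlMr ?exprn_gt0 //.
  apply: (@cvgn_norm_le _ (fun M => (X l M).[t] - \sum_(k < N) (X l N)`_k * t ^+ k)).
    by apply: cvgB; [case: (c_cvg l t tr)|apply: cvg_cst].
  exists N => // M /= leNM; rewrite ler_pdivlMr ?exprn_gt0 //.
  have tr' : `|t| <= r by apply: (le_trans tr); rewrite ler_pdivrMr // ler_pMr // ler1n.
  rewrite (eq_bigr (fun k : 'I_N => (X l M)`_k * t ^+ k)); last first.
    move=> k _; have lek := ltnW (ltn_ord k).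
    by rewrite (stable_coef (X_eq l) lek) (stable_coef (X_eq l) (leq_trans lek leNM)).
  apply: (le_trans (pnorm_tail (X l M) N r_ge0 tr')).
  by rewrite ler_wpM2l ?exprn_ge0.
have c_small l t : `|t| <= r / 2 -> `|c t 0 l| <= `|t| * (W / r).
  move=> tr; have := c_tail l t 1%N tr isT.
  by rewrite big_ord1 X0 mul0r subr0 !expr1 mulrA -ler_pdivlMr.
have Wr0 : 0 <= W / r by rewrite divr_ge0.
have Wr1 : 0 < W / r + 1 by rewrite ltr_wpDl.
have [dR [dR0 dRd dRR]] := exists_pos_le d0 R0.
(* The summand 1 keeps the denominator positive even if W = 0. *)
have [eps [eps0 eps_r eps_d]] : exists e, [/\ 0 < e, e <= r / 2 & e <= dR / (W / r + 1)].
  by apply: exists_pos_le; rewrite divr_gt0.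
have c_lt l t : 0 < t < eps -> `|c t 0 l| < dR.
  move=> /andP[t0 te]; rewrite (le_lt_trans (c_small l t _)) //.
    by rewrite gtr0_norm // (le_trans (ltW te)).
  rewrite gtr0_norm // (@le_lt_trans _ _ (t * (W / r + 1))) //.
    by rewrite ler_wpM2l ?(ltW t0) // lerDl.
  by rewrite -ltr_pdivlMr // (lt_le_trans te).
exists eps, c; split=> //.
- move=> t te; have /andP[t0 lt_te] := te.
  have tr : `|t| <= r / 2 by rewrite gtr0_norm // (le_trans (ltW lt_te)).
  split=> [i|l]; last by apply: (lt_le_trans (c_lt l t te)).
  have /(series_cvg (hf i)) f_cvg l : `|c t 0 l| <= R.
    by apply/ltW/(lt_le_trans (c_lt l t te)).
  apply: (cvgn_unique f_cvg).
  (* The partial sum of f_i of order J at c(t) is the limit in N of polynomials that vanish modulo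
     t^J and have norm at most S. It is thus at most S / 2^J, and f_i(c(t)) = 0 as J grows. *)
  apply: (half_expn_bound_cvg hK (T := S)) => J; rewrite sub0r normrN.
  apply: (@cvgn_norm_le _ (fun N => (arc_poly polyC (a i) J (u 0) (Z N)).['X].[t])).
    under eq_fun do rewrite arc_poly_hornerX.
    apply: cvg_big => [|j _]; first exact: add_continuous.
    by apply: meval_cvg => l; case: (c_cvg l t tr).
  exists J => // N /= leJN.
  have := pnorm_tail_half (arc_poly polyC (a i) J (u 0) (Z N)).['X] J r0 tr.
  rewrite big1 ?subr0 => [/le_trans|k _]; last by rewrite arc0 ?coef0 ?mul0r.
  by apply; rewrite ler_wpM2l ?exprn_ge0 ?invr_ge0.
- move=> t0 /andP[t0_gt0 t0e] l.
  (* Since t0 < eps <= r / 2, the disc of radius r / 2 around t0 stays in the disc of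
     convergence. *)
  have t0r : `|t0| + r / 2 <= r.
    rewrite gtr0_norm // -lerBrDr (le_trans (ltW t0e)) //.
    by rewrite [X in _ <= X - _]splitr addrK.
  have r2_gt0 : 0 < r / 2 by rewrite divr_gt0.
  have [b hb] := @power_series_recenter K hK (fun k => (X l k)`_k) _ _ _ _
    r_ge0 r2_gt0 t0r (stable_coef_bound r0 (XW l) (X_eq l)).
  exists b.
  have near_t0 : \forall t \near t0, `|t0 - t| <= r / 2 / 2.
    have /cvgrPdist_le := @cvg_id _ (nbhs t0); apply.
    by rewrite !divr_gt0.
  apply: filterS near_t0 => t t_t0 /andP[t_gt0 te].
  rewrite seriesEord; apply: hb; first by rewrite distrC.
  by have [] := c_cvg l t; rewrite ?gtr0_norm ?(le_trans (ltW te)).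
- apply/cvg_rowP => l; rewrite [X in _ --> X]mxE; apply/cvgr0Pnorm_le => e e0.
  (* The remainder is at most W t^3 / r^3; divided by t^2 it is at most e once t <= e / (W / r^3 +
     1). *)
  have W3 : 0 < W / r ^+ 3 + 1 by rewrite ltr_wpDl // divr_ge0 // exprn_ge0.
  near=> t.
  have t0 : 0 < t by near: t; apply: nbhs_right_gt.
  have tr : `|t| <= r / 2.
    by rewrite gtr0_norm //; near: t; apply: nbhs_right_le; rewrite divr_gt0.
  have te : t <= e / (W / r ^+ 3 + 1).
    by near: t; apply: nbhs_right_le; rewrite divr_gt0.
  rewrite !mxE; have := c_tail l t 3%N tr isT.
  rewrite !big_ord_recr big_ord0 /= X0 X1 X2 mul0r !add0r expr1 mxE => h.
  rewrite normrM normfV normrX gtr0_norm // mulrC ler_pdivrMr ?exprn_gt0 //.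
  rewrite [t * _]mulrC [t ^+ 2 * _]mulrC.
  rewrite -(@ler_pM2r _ (r ^+ 3)) ?exprn_gt0 //; apply: (le_trans h).
  rewrite gtr0_norm // exprS -mulrA [t * _]mulrC -[leLHS]mulrA [e * _]mulrC -[leRHS]mulrA.
  rewrite ler_wpM2l ?exprn_ge0 ?(ltW t0) //.
  rewrite ler_pdivlMr // in te; rewrite -ler_pdivrMr ?exprn_gt0 //.
  apply: le_trans te; rewrite mulrC -mulrA ler_wpM2l ?(ltW t0) // lerDl.
  exact: ler01.
Unshelve. all: by end_near. Qed.

End AnalyticSolution.

(** * Real and complex numbers *)

Section CompleteFields.
Context {R : realType}.

Lemma complete_field_real : complete_field R.
Proof.
split; first exact: cvg_harmonic.
move=> a [M aM].
have normE : [normed series a] = fun N => \sum_(k < N) `|a k|.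
  by apply/funext => N; rewrite /= seriesEord.
have /normed_cvg/cvg_ex[l] : cvgn [normed series a].
  rewrite normE; apply: nondecreasing_is_cvgn; last by exists M => _ [N _ <-].
  by move=> j k lejk; rewrite -(subnKC lejk) big_split_ord lerDl sumr_ge0.
by rewrite seriesEord; exists l.
Qed.

Let C := (R[i] : numFieldType).

Lemma real_complex_cvg (u v : nat -> R) (x y : R) :
  u @ \oo --> x -> v @ \oo --> y ->
  (fun k => u k +i* v k : C) @ \oo --> (x +i* y : C).
Proof.
move=> /cvgrPdist_lt ux /cvgrPdist_lt vy; apply/cvgrPdist_lt => e e0.
have [e' eE] : exists e', e = e'%:C.
  by apply/complex_realP/gtr0_real.
have e'0 : 0 < e' / 2 by rewrite divr_gt0 // -ltcR -eE.
have := ux _ e'0; have := vy _ e'0; apply: filterS2 => k hv hu.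
rewrite eE.
have -> : (x +i* y : C) - (u k +i* v k : C) = (x - u k)%:C + 'i%C * (y - v k)%:C.
  by rewrite [LHS]complexE.
apply: (le_lt_trans (ler_normD _ _)); rewrite normrM !normc_def /=.
rewrite !expr0n /= !addr0 expr1n add0r sqrtr1 mul1r !sqrtr_sqr -rmorphD /= ltcR.
by rewrite [ltRHS]splitr ltrD.
Qed.

Lemma normc_ge_Im (z : R[i]) : `|complex.Im z|%:C <= `|z|.
Proof.
have -> : `|z| = `|z * 'i%C|.
  by rewrite normrM [X in _ * X]normc_def /= expr0n expr1n add0r sqrtr1 mulr1.
by rewrite -normrN -ReiNIm normc_ge_Re.
Qed.

Lemma complete_field_complex : complete_field C.
Proof.
have [harm real_cvg] := complete_field_real; split.
  rewrite (_ : (fun k => _) = fun k => (k.+1%:R^-1 +i* 0 : C)).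
    exact: (real_complex_cvg harm (cvg_cst 0)).
  by apply/funext => k; rewrite complexr0 -(rmorph_nat (real_complex R)) -fmorphV.
move=> a [M aM].
(* The empty sum gives 0 <= M, hence M is real. *)
have M_real : (complex.Re M)%:C = M.
  by apply/RRe_real/ger0_real; have := aM 0%N; rewrite big_ord0.
have [|x hx] := real_cvg (fun k => complex.Re (a k)).
  exists (complex.Re M) => N; rewrite -lecR M_real rmorph_sum.
  by apply: le_trans (aM N); apply: ler_sum => k _; apply: normc_ge_Re.
have [|y hy] := real_cvg (fun k => complex.Im (a k)).
  exists (complex.Re M) => N; rewrite -lecR M_real rmorph_sum.
  by apply: le_trans (aM N); apply: ler_sum => k _; apply: normc_ge_Im.
exists (x +i* y); rewrite (_ : (fun N => _) = fun N =>
   ((\sum_(k < N) complex.Re (a k)) +i* (\sum_(k < N) complex.Im (a k))) : C).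
  exact: real_complex_cvg.
apply/funext => N; rewrite [LHS]complexE [RHS]complexE /=.
by rewrite !raddf_sum.
Qed.

End CompleteFields.

(** * Second-order tangents *)

Section SecondOrderTangents.
Context {K : numFieldType} (hK : complete_field K) {n : nat}.
Implicit Types (X : set 'rV[K]_n) (f g : 'rV[K]_n -> K) (u w : 'rV[K]_n).

(** If all components vanished, the series would sum to the zero germ; so [order0] is a genuine
    order and not its default value. *)
Lemma nonzero_germ_order g R S :
  series_data g (taylor g) R S -> ~ zero_germ g ->
  forall j, (j < order0 g)%N -> component g j = 0.
Proof.
move=> hg nz; have [[j gj]|no] := pselect (exists j, component g j != 0).
  by have [] := order0P gj.
case: nz; apply/near_row0P; exists R => [|x xR]; first exact: radius_gt0 hg.
have := series_cvg hg (fun i => ltW (xR i)).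
have g0 j : homog_part (taylor g) j = 0.
  by apply: contrapT => /eqP gj; apply: no; exists j.
move=> gx; apply: (cvgn_unique gx).
rewrite (_ : (fun J => _) = fun=> 0); first exact: cvg_cst.
by apply/funext => J; rewrite big1 // => j _; rewrite g0 meval0.
Qed.

Lemma second_tangent_algebraic X u :
  second_tangent_set X u `<=` algebraic_second_tangent_set X u.
Proof.
move=> w [t [w_ [t0 _ t_cvg w_cvg tX]]] g [/taylorP/power_series_data[R [S hg]] gX] nz.
have a0 := nonzero_germ_order hg nz.
pose x k := t k *: u + (2^-1 * t k ^+ 2) *: w_ k.
have x_cvg : x @ \oo --> (0 : 'rV[K]_n).
  apply/cvg_rowP => i; rewrite mxE.
  have /cvg_rowP/(_ i) w_i := w_cvg.
  rewrite (_ : (fun k => _) = fun k => t k * u 0 i + 2^-1 * (t k * t k) * w_ k 0 i).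
    have -> : (0 : K) = 0 * u 0 i + 2^-1 * (0 * 0) * w 0 i.
      by rewrite !mul0r mulr0 mul0r addr0.
    apply: cvgD; first by apply: cvgM; [exact: t_cvg|exact: cvg_cst].
    by apply: cvgM; [apply: cvgM; [exact: cvg_cst|apply: cvgM]|exact: w_i].
  by apply/funext => k; rewrite !mxE expr2.
have [] := @arc_initial_terms _ _ g _ R S (order0 g) t (fun=> u 0)
  (fun k i => 2^-1 * w_ k 0 i) x (u 0) (fun i => 2^-1 * w 0 i) hg a0 t0 t_cvg.
- by move=> i; apply: cvg_cst.
- by move=> i; apply: cvgM; [apply: cvg_cst|apply: (cvg_rowP _ _).1].
- by move=> k i; rewrite !mxE mulrC; congr (_ + _); rewrite mulrAC.
- have h : \forall k \near \oo, X (x k) -> g (x k) = 0 := x_cvg _ gX.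
  by apply: filterS h => k; apply; exact: tX.
move=> _ /(_ (fun=> erefl)) h; rewrite -[RHS]h addrC mulr_sumr; congr (_ + _).
by apply: eq_bigr => i _; rewrite mxE mulrCA.
Qed.

(** A tangent sequence is an arc with parameter s_k = 1 / t_k, direction t_k x_k and z = 0. Here u
    != 0 forces s_k -> 0: if u_i != 0, then 1 / t_k is eventually at most 2 |x_k,i| / |u_i|. *)
Lemma tangent_cone_initial X u g R S m : tangent_cone X u -> u != 0 ->
  (\forall x \near (0 : 'rV[K]_n), X x -> g x = 0) ->
  series_data g (taylor g) R S -> (forall j, (j < m)%N -> component g j = 0) ->
  meval (u 0) (component g m) = 0.
Proof.
move=> [x [t [hx x_cvg tx_cvg]]] u0 gX hg a0.
have [i ui] : exists i, u 0 i != 0.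
  apply: contrapT => no; move: u0; rewrite (_ : u = 0) ?eqxx //.
  apply/rowP => i; rewrite mxE; apply: contrapT => /eqP ui; apply: no.
  by exists i.
have v_cvg l : (fun k => (t k *: x k) 0 l) @ \oo --> u 0 l by apply: (cvg_rowP _ _).1.
have x0_cvg l : (fun k => x k 0 l) @ \oo --> (0 : K).
  by have /cvg_rowP/(_ l) := x_cvg; rewrite mxE.
have t0 k : 0 < t k by case: (hx k).
have s_cvg : (fun k => (t k)^-1) @ \oo --> (0 : K).
  apply: (cvgn_squeeze0 (C := (`|u 0 i| / 2)^-1)) (x0_cvg i).
  have ui2 : 0 < `|u 0 i| / 2 by rewrite divr_gt0 // normr_gt0.
  have /cvgrPdist_le/(_ _ ui2) := v_cvg i; apply: filterS => k hk.
  rewrite mxE in hk; have hv : `|u 0 i| / 2 <= `|t k * x k 0 i|.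
    rewrite -(lerD2l (`|u 0 i| / 2)) -splitr.
    apply: (@le_trans _ _ (`|u 0 i - t k * x k 0 i| + `|t k * x k 0 i|)).
      by rewrite -{1}(subrK (t k * x k 0 i) (u 0 i)) ler_normD.
    by rewrite lerD2r.
  rewrite ler_pdivlMl // normfV ler_pdivrMr ?normr_gt0 ?gt_eqF //.
  by rewrite [leRHS]mulrC -normrM.
have [] // := @arc_initial_terms _ _ g _ R S m (fun k => (t k)^-1)
  (fun k i => (t k *: x k) 0 i) (fun _ _ => 0) x (u 0) (fun=> 0) hg a0.
- by move=> k; rewrite invr_gt0.
- by move=> l; apply: cvg_cst.
- by move=> k l; rewrite mul0r addr0 mxE mulrAC mulfV ?mul1r // gt_eqF.
- have h : \forall k \near \oo, X (x k) -> g (x k) = 0 := x_cvg _ gX.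
  by apply: filterS h => k; apply; case: (hx k).
Qed.

(* Otherwise all the arcs s u + s^2 z lie in the zero set of g, hence
   g_(m+1)(u) + <grad g_m(u), z> = 0 for every z. *)
Lemma nonzero_germ_gradient g u R S :
  series_data g (taylor g) R S ->
  (forall j, (j < order0 g)%N -> component g j = 0) ->
  gradient (initial_form g) u != 0 -> ~ zero_germ g.
Proof.
move=> hg a0 /negP grad g0; apply: grad; apply/eqP/rowP => i; rewrite !mxE.
have key (z : 'I_n -> K) : meval (u 0) (component g (order0 g).+1)
    + \sum_(i < n) meval (u 0) (mderiv i (component g (order0 g))) * z i = 0.
  pose s k : K := k.+1%:R^-1.
  have s_cvg : s @ \oo --> (0 : K) by case: hK.
  pose x k : 'rV[K]_n := \row_l (u 0 l * s k + z l * s k ^+ 2).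
  have x_cvg : x @ \oo --> (0 : 'rV[K]_n).
    apply/cvg_rowP => l; rewrite mxE.
    rewrite (_ : (fun k => _) = fun k => u 0 l * s k + z l * (s k * s k)).
      have -> : (0 : K) = u 0 l * 0 + z l * (0 * 0) by rewrite !mulr0 addr0.
      apply: cvgD; first by apply: cvgM; [exact: cvg_cst|exact: s_cvg].
      by apply: cvgM; [exact: cvg_cst|apply: cvgM].
    by apply/funext => k; rewrite mxE expr2.
  have [] // := @arc_initial_terms _ _ g _ R S (order0 g) s (fun=> u 0) (fun=> z)
    x (u 0) z hg a0.
  - by move=> k; rewrite invr_gt0.
  - by move=> l; apply: cvg_cst.
  - by move=> l; apply: cvg_cst.
  - by move=> k l; rewrite mxE.
  - exact: x_cvg _ g0.
  by move=> _; apply.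
have := key (fun l => (l == i)%:R); have := key (fun=> 0).
rewrite big1 ?addr0 => [->|l _]; last by rewrite mulr0.
rewrite add0r (bigD1 i) //= eqxx mulr1 big1 ?addr0 // => l /negbTE ->.
by rewrite mulr0.
Qed.

Lemma realizable_second_tangent X u :
  second_order_realizable X u ->
  algebraic_second_tangent_set X u `<=` second_tangent_set X u.
Proof.
move=> hr w /hr[eps [c [eps0 cX _ c_lim]]].
have half0 : 0 < eps / 2 by rewrite divr_gt0.
pose t k : K := eps / 2 * k.+1%:R^-1.
have t0 k : 0 < t k by rewrite mulr_gt0 // invr_gt0.
have t_lt k : t k < eps.
  apply: (@le_lt_trans _ _ (eps / 2)).
    by rewrite ler_piMr ?(ltW half0) // invf_le1 // ler1n.
  by rewrite ltr_pdivrMr // ltr_pMr // ltr1n.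
have t_cvg : t @ \oo --> (0 : K).
  have -> : (0 : K) = eps / 2 * 0 by rewrite mulr0.
  by apply: cvgM; [apply: cvg_cst|case: hK].
have t_right : t @ \oo --> (0 : K)^'+.
  move=> A hA; have h : \forall k \near \oo, 0 < t k -> A (t k) := t_cvg _ hA.
  by apply: filterS h => k; apply.
pose G s : 'rV[K]_n := s ^- 2 *: (c s - (s *: u + (2^-1 * s ^+ 2) *: w)).
have Gt : (fun k => G (t k)) @ \oo --> (0 : 'rV[K]_n).
  exact: cvg_comp t_right c_lim.
(* The w_k solve c(t_k) = t_k u + t_k^2 w_k / 2, whence the factor 2 on the rescaled error. *)
exists t, (fun k => w + 2 *: G (t k)); split=> //.
- move=> j k lejk; rewrite /t ler_wpM2l ?(ltW half0) //.
  by rewrite lef_pV2 ?posrE // ler_nat ltnS.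
- apply/cvg_rowP => i; rewrite (_ : (fun k => _) = fun k => w 0 i + 2 * G (t k) 0 i).
    rewrite -[X in _ --> X]addr0 -[X in _ --> _ + X](mulr0 2).
    apply: cvgD; first exact: cvg_cst.
    apply: cvgM; first exact: cvg_cst.
    by have /cvg_rowP/(_ i) := Gt; rewrite mxE.
  by apply/funext => k; rewrite !mxE.
- move=> k.
  suff -> : t k *: u + (2^-1 * t k ^+ 2) *: (w + 2 *: G (t k)) = c (t k).
    by apply: cX; rewrite t0 t_lt.
  have e1 : 2^-1 * t k ^+ 2 * 2 * t k ^- 2 = 1.
    by rewrite (mulrAC 2^-1) mulVf ?pnatr_eq0 // mul1r mulfV // expf_neq0 // gt_eqF.
  by rewrite scalerDr addrA /G !scalerA e1 scale1r subrKC.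
Qed.

Lemma nondegenerate_realizable p X (f : 'I_p -> 'rV[K]_n -> K) u :
  (forall i, analytic_germ (f i)) ->
  (\forall x \near (0 : 'rV[K]_n), X x <-> forall i, f i x = 0) ->
  tangent_cone X u -> u != 0 ->
  \rank (\matrix_(i < p) gradient (initial_form (f i)) u) = p ->
  second_order_realizable X u.
Proof.
move=> f_an f_X hu u0 hrank w hw.
have /row_freeP[B hB] : row_free (\matrix_(i < p) gradient (initial_form (f i)) u).
  by rewrite /row_free hrank.
have aB i k : \sum_(l < n) meval (u 0) (mderiv l (initial_form (f i))) * B l k
    = (i == k)%:R.
  have := congr1 (fun M : 'M[K]_p => M i k) hB; rewrite !mxE => <-.
  by apply: eq_bigr => l _; rewrite !mxE.
have grad0 i : gradient (initial_form (f i)) u != 0.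
  apply/eqP => gr0; have := aB i i; rewrite eqxx big1 => [/eqP|l _].
    by rewrite eq_sym oner_eq0.
  by have := congr1 (fun M : 'rV[K]_n => M 0 l) gr0; rewrite !mxE => ->; rewrite mul0r.
have a0 i : forall j, (j < order0 (f i))%N -> component (f i) j = 0.
  (* A zero initial form would have zero gradient; this rules out the default value of [order0]. *)
  have fi0 : component (f i) (order0 (f i)) != 0.
    apply: contra (grad0 i) => /eqP fi0; apply/eqP/rowP => l.
    by rewrite !mxE /initial_form fi0 mderiv0 meval0.
  by have [] := order0P fi0.
have vanish i : vanishing_ideal X (f i).
  by split=> //; apply: filterS f_X => x [+ _] => /[apply].
have data i : exists RS : K * K, series_data (f i) (taylor (f i)) RS.1 RS.2.
  by have [R [S h]] := power_series_data (taylorP (f_an i)); exists (R, S).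
have [RS hRS] := choice data.
(* Common data for all f_i: R is below every radius without taking a minimum, and positive even for
   p = 0. *)
pose S := \sum_i (RS i).2; pose R := (1 + \sum_i (RS i).1^-1)^-1.
have R_gt0 i : 0 < (RS i).1 := radius_gt0 (hRS i).
have S_ge0 i : 0 <= (RS i).2 := bound_ge0 (hRS i).
have sumV0 : 0 <= \sum_i (RS i).1^-1 by apply: sumr_ge0 => i _; rewrite invr_ge0 ltW.
have R0 : 0 < R by rewrite invr_gt0 ltr_wpDr.
have S0 : 0 <= S by apply: sumr_ge0.
have hf i : series_data (f i) (taylor (f i)) R S.
  apply: series_data_shrink (hRS i) => //.
    rewrite -[leRHS]invrK lef_pV2 ?posrE ?invr_gt0 // ?ltr_wpDr //.
    rewrite (bigD1 i) //= addrCA lerDl addr_ge0 // sumr_ge0 // => k _.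
    by rewrite invr_ge0 ltW.
  by rewrite /S (bigD1 i) //= lerDl sumr_ge0.
have [d d0 hd] := (near_row0P _).1 f_X.
have [||eps [c [eps0 hc c_an c_lim]]] :=
  analytic_arc hK R0 S0 hf a0 _ (w := 2^-1 *: w) _ aB d0.
- by move=> i; apply: (tangent_cone_initial hu u0 _ (hf i) (a0 i)); case: (vanish i).
(* The equations satisfied by w are available for nonzero germs only. *)
- move=> i; have nz := nonzero_germ_gradient (hf i) (a0 i) (grad0 i).
  have hwi := hw _ (vanish i) nz; rewrite -[RHS]hwi [RHS]addrC mulr_sumr; congr (_ + _).
  by apply: eq_bigr => l _; rewrite !mxE mulrCA.
exists eps, c; split=> //.
- by move=> t te; have [ft ct] := hc t te; apply/(hd _ ct).
- move: c_lim; under eq_fun do rewrite scalerA [_ ^+ 2 * _]mulrC.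
  exact.
Qed.

End SecondOrderTangents.

Theorem proposition4p6 (R : realType) (K : numFieldType)
  (hK : K = (R : numFieldType) \/ K = (R[i] : numFieldType))
  (n p : nat) (X : set 'rV[K]_n) (f : 'I_p -> 'rV[K]_n -> K)
  (hX : complete_intersection X f)
  (u : 'rV[K]_n) (hu : tangent_cone X u) (hu0 : u != 0)
  (hnondeg : \rank (\matrix_(i < p) gradient (initial_form (f i)) u) = p) :
  second_order_realizable X u /\
  second_tangent_set X u = algebraic_second_tangent_set X u.
Proof.
have cK : complete_field K.
  by case: hK => ->; [apply: complete_field_real|apply: complete_field_complex].
have [f_an _ _ f_X] := hX.
have hr := nondegenerate_realizable cK f_an f_X hu hu0 hnondeg.
split=> //; apply/seteqP; split; first exact: second_tangent_algebraic.
exact: realizable_second_tangent.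
Qed.
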